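(* Let $X_1, X_2, X_3, X_4, X_5$ be the graphs defined in the context. Suppose that $F$ is a graph with no isolated vertices that is not isomorphic to $X_5$. Then Painter wins the online Ramsey game for $C_3$ on the class of $F$-free graphs if and only if $F$ is isomorphic to a subgraph of a graph in $\{X_1, X_2, X_3, X_4\}$.
   Context: All graphs are finite and simple (except that the game board has an unbounded supply of vertices, with only finitely many edges at each moment). A graph is $F$-free if it does not contain $F$ as a (not necessarily induced) subgraph. Online Ramsey game for $H$ on $\mathcal{C}$, where $\mathcal{C}$ is a class of graphs and $H$ is a fixed graph: the initial state is an unbounded (infinite) set of vertices with no edges. On each turn Builder introduces a new edge between two vertices, with the constraint that the resulting graph must be in $\mathcal{C}$, and then Painter colors the new edge either red or blue (permanently). Builder wins the game if he has a strategy that forces Painter to make a monochromatic copy of $H$ at some point (after finitely many turns). Otherwise, i.e. if Painter can avoid creating a monochromatic copy of $H$ forever, Painter wins. $C_3$ is the triangle. The graphs: - $X_1$ has vertices $u,v,w,a,b,c$ and edges $uv, vw, uw, ua, ub, vc$ (a triangle with two pendant edges at one vertex and one pendant edge at another vertex). - $X_2$ has vertices $a,b,c,d,e,f$ and edges $ab, bc, ca, cd, de, df$ (a triangle joined by an edge to a vertex $d$ having two leaf neighbors). - $X_3$ has vertices $a,b,c,d,p$ and edges $ab, ac, ad, bc, bd, ap$ ($K_4$ minus an edge, with a pendant edge attached at a vertex of degree 3). - $X_4$ has vertices $a,b,c,d,p$ and edges $ab, ac, ad, bc, bd, cp$ ($K_4$ minus an edge, with a pendant edge attached at a vertex of degree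 2). - $X_5$ has vertices $a,b,c,d,p,q$ and edges $ab, bc, cd, da, ap, aq$ (a 4-cycle with two pendant edges at the same vertex). *)

(* Defs.v *)
From mathcomp Require Import all_boot.

Set Implicit Arguments.
Unset Strict Implicit.
Unset Printing Implicit Defensive.

Record sgraph := SGraph {
  vertex :> finType;
  edge : rel vertex;
  edge_sym : symmetric edge;
  edge_irrefl : irreflexive edge }.

Arguments edge {s}.

(* Not necessarily induced.  The host is an arbitrary relation so that it can
   be a finite graph as well as the infinite game board. *)
Definition contains_copy (V : Type) (adj : rel V) (F : sgraph) : Prop :=
  exists f : F -> V,
    injective f /\ (forall x y : F, edge x y -> adj (f x) (f y)).

Definition iso_to_subgraph (F G : sgraph) : Prop :=
  contains_copy (@edge G) F.

Definition isomorphic (F G : sgraph) : Prop :=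
  exists f : F -> G,
    bijective f /\ (forall x y : F, edge (f x) (f y) = edge x y).

Definition no_isolated_vertices (F : sgraph) : Prop :=
  forall x : F, exists y : F, edge x y.

Definition edges_rel (n : nat) (s : seq (nat * nat)) : rel 'I_n := fun x y =>
  (x != y) && (((val x, val y) \in s) || ((val y, val x) \in s)).

Lemma edges_rel_sym (n : nat) (s : seq (nat * nat)) :
  symmetric (@edges_rel n s).
Proof. by move=> x y; rewrite /edges_rel eq_sym orbC. Qed.

Lemma edges_rel_irrefl (n : nat) (s : seq (nat * nat)) :
  irreflexive (@edges_rel n s).
Proof. by move=> x; rewrite /edges_rel eqxx. Qed.

Definition graph_of_edges (n : nat) (s : seq (nat * nat)) : sgraph :=
  SGraph (@edges_rel_sym n s) (@edges_rel_irrefl n s).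

Definition C3 := graph_of_edges 3 [:: (0, 1); (1, 2); (2, 0)].

(* u, v, w, a, b, c = 0, 1, 2, 3, 4, 5 *)
Definition X1 :=
  graph_of_edges 6 [:: (0, 1); (1, 2); (2, 0); (0, 3); (0, 4); (1, 5)].

(* a, b, c, d, e, f = 0, 1, 2, 3, 4, 5 *)
Definition X2 :=
  graph_of_edges 6 [:: (0, 1); (1, 2); (2, 0); (2, 3); (3, 4); (3, 5)].

(* a, b, c, d, p = 0, 1, 2, 3, 4 *)
Definition X3 :=
  graph_of_edges 5 [:: (0, 1); (0, 2); (0, 3); (1, 2); (1, 3); (0, 4)].

(* a, b, c, d, p = 0, 1, 2, 3, 4 *)
Definition X4 :=
  graph_of_edges 5 [:: (0, 1); (0, 2); (0, 3); (1, 2); (1, 3); (2, 4)].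

(* a, b, c, d, p, q = 0, 1, 2, 3, 4, 5 *)
Definition X5 :=
  graph_of_edges 6 [:: (0, 1); (1, 2); (2, 3); (3, 0); (0, 4); (0, 5)].

(* The game board has vertex set nat.  A position is the list of the edges
   played so far, latest first, each with the colour chosen by Painter (the
   two values of bool stand for red and blue). *)
Definition position : Type := seq (nat * nat * bool).

Definition position_adj (p : position) : rel nat := fun x y =>
  has (fun m : nat * nat * bool => (m.1 == (x, y)) || (m.1 == (y, x))) p.

Definition colour_adj (p : position) (c : bool) : rel nat :=
  position_adj [seq m <- p | m.2 == c].

Definition mono_copy (H : sgraph) (p : position) : Prop :=
  exists c : bool, contains_copy (colour_adj p c) H.

(* A class of graphs is given by the graphs on the vertex set of the board
   that belong to it. *)
Definition graph_class : Type := rel nat -> Prop.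

Definition free_class (F : sgraph) : graph_class :=
  fun adj => ~ contains_copy adj F.

(* The colour in the last clause is irrelevant: position_adj ignores it. *)
Definition legal_move (C : graph_class) (p : position) (m : nat * nat) : Prop :=
  [/\ m.1 != m.2, ~~ position_adj p m.1 m.2
    & C (position_adj ((m, true) :: p))].

Definition builder_strategy : Type := position -> nat * nat.

Fixpoint play (sigma : builder_strategy) (col : nat -> bool) (n : nat)
    : position :=
  if n is k.+1 then
    let p := play sigma col k in (sigma p, col k) :: p
  else [::].

(* Builder's moves are determined by the position, so quantifying over all
   colour sequences covers every way in which Painter can answer sigma. *)
Definition winning_strategy (H : sgraph) (C : graph_class)
    (sigma : builder_strategy) : Prop :=
  forall col : nat -> bool, exists n : nat,
    (forall k, k < n ->
       legal_move C (play sigma col k) (sigma (play sigma col k)))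
    /\ mono_copy H (play sigma col n).

Definition builder_wins (H : sgraph) (C : graph_class) : Prop :=
  exists sigma : builder_strategy, winning_strategy H C sigma.

Definition painter_wins (H : sgraph) (C : graph_class) : Prop :=
  ~ builder_wins H C.

(* Main.v *)
From Stdlib Require Import Classical ClassicalEpsilon.
Require Import Defs.
From mathcomp Require Import all_boot.

(** Enlarging F enlarges the class of F-free graphs and so helps Builder, and
    the theorem is a list of strategies for the two players.

    Painter needs one strategy for each of X1, X2, X3 and X4.  All of them
    answer red unless a local danger calls for blue; one such danger is a red
    triangle, so only a blue triangle has to be excluded.  If this were the only
    danger, every edge of a blue triangle would span a red path of length two.
    When the three middle vertices are distinct, the board contains a triangle
    with a further triangle on each side, hence every X_i; when they coincide,
    the board contains a K4 whose edges at one vertex are red and whose other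
    edges are blue.  Preventing this K4 requires some further blue answers, and
    these must not open the way to other blue triangles.
    - On X1-free boards Painter can keep the red graph of maximal degree two and
      without 4-cycles ([painter_wins_X1]).
    - On X3-free and on X4-free boards a K4 is a whole component, so that it is
      enough that the four vertices of a red star with three leaves never form a
      component ([painter_wins_diamond]).
    - On X2-free boards a K4 can have tails.  Painter refuses a red star with
      three leaves exactly if the board with the K4 added would still be
      X2-free, and refuses red 4-cycles in components on at most five vertices
      ([painter_wins_X2]).
    Each strategy is given by an invariant of the red and the blue graph that
    one of the two answers to any edge preserves ([painter_wins_triangle]).

    Builder can play a star with five edges, three of which have the same
    colour, and then a triangle on the ends of these three.  The board never
    leaves K4 with two leaves at one vertex, so this wins unless F is a subgraph
    of that graph ([builder_wins_star]).  Deleting the edges of K4 with two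
    leaves one by one shows that every subgraph F of it lies in some X_i, is X5,
    or contains K4, the star with five edges, or the forked diamond, which is K4
    minus an edge with two leaves at a vertex of degree two
    ([reducible_sound]).  Against the three graphs of the last kind Builder has
    explicit finite plans on boards that avoid them ([builder_wins_on]). *)

Set Implicit Arguments.
Unset Strict Implicit.
Unset Printing Implicit Defensive.

(** * Copies of a graph *)

Lemma contains_copy_mono (V : Type) (E E' : rel V) (F : sgraph) :
  (forall x y, E x y -> E' x y) -> contains_copy E F -> contains_copy E' F.
Proof. by move=> sub [f [injf Ef]]; exists f; split=> // x y /Ef/sub. Qed.

Lemma contains_copy_trans (V : Type) (E : rel V) (F G : sgraph) :
  iso_to_subgraph F G -> contains_copy E G -> contains_copy E F.
Proof.
move=> [f [injf Ef]] [g [injg Eg]]; exists (g \o f); split.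
  exact: inj_comp.
by move=> x y /Ef/Eg.
Qed.

Lemma contains_copy_seq (n : nat) (s : seq (nat * nat)) (E : rel nat) l :
  symmetric E -> size l = n -> uniq l ->
  all (fun e => E (nth 0 l e.1) (nth 0 l e.2)) s ->
  contains_copy E (graph_of_edges n s).
Proof.
move=> symE sl ul /allP El; exists (fun i : 'I_n => nth 0 l i); split.
  move=> i j /eqP; rewrite nth_uniq ?sl ?ltn_ord // => /eqP; exact: val_inj.
move=> i j /andP[_ /orP[] /El //=]; by rewrite symE.
Qed.

(** * Painter strategies from invariants *)

Section Painter.

Variables (H : sgraph) (C : graph_class) (I : position -> Prop).
Hypothesis I_nil : I [::].
Hypothesis I_step : forall p m, I p -> legal_move C p m ->
  exists c, I ((m, c) :: p).
Hypothesis I_safe : forall p, I p -> ~ mono_copy H p.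

(** Builder's next edge depends on the position alone, so choosing at each
    position a colour that keeps the invariant defines a whole run against any
    strategy of Builder. *)
Lemma painter_wins_invariant : painter_wins H C.
Proof.
move=> [sigma win].
pose paint p : bool :=
  if excluded_middle_informative (I ((sigma p, true) :: p)) then true else false.
pose pos := fix pos n := if n is k.+1 then (sigma (pos k), paint (pos k)) :: pos k
                         else [::].
have playE k : play sigma (paint \o pos) k = pos k by elim: k => //= k ->.
have [n [legal mono]] := win (paint \o pos).
rewrite playE in mono; apply: I_safe mono.
have: n <= n by []; move: {1 3}n; elim=> //= k IHk ltkn.
have /I_step : I (pos k) by apply: IHk (ltnW _).
move/(_ (sigma (pos k))); rewrite -{2}playE -{1}playE => /(_ (legal k ltkn)).
rewrite /paint; case: excluded_middle_informative => // nI [[] //].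
Qed.

End Painter.

Definition add_edge (m : nat * nat) (E : rel nat) : rel nat :=
  fun x y => (m == (x, y)) || (m == (y, x)) || E x y.

Lemma add_edge_sub m (E : rel nat) x y : E x y -> add_edge m E x y.
Proof. by rewrite /add_edge orbC => ->. Qed.

Lemma add_edge_new u v (E : rel nat) : add_edge (u, v) E u v.
Proof. by rewrite /add_edge eqxx. Qed.

Lemma add_edgeP u v (E : rel nat) x y :
  add_edge (u, v) E x y <-> [\/ x = u /\ y = v, x = v /\ y = u | E x y].
Proof.
split=> [/orP[/orP[]/eqP[-> ->]|Exy]|[[-> ->]|[-> ->]|/add_edge_sub]] //.
- by constructor 1.
- by constructor 2.
- by constructor 3.
- exact: add_edge_new.
- by rewrite /add_edge eqxx orbT.
Qed.

Record colouring (R B : rel nat) : Prop := Colouring {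
  red_sym : symmetric R;
  blue_sym : symmetric B;
  red_irr : forall x, R x x -> False;
  blue_irr : forall x, B x x -> False;
  red_blue : forall x y, R x y -> B x y -> False }.

Lemma colouring_swap R B : colouring R B -> colouring B R.
Proof. by case=> *; split; eauto. Qed.

Lemma colouring_red R B u v : colouring R B ->
  u <> v -> ~ R u v -> ~ B u v -> colouring (add_edge (u, v) R) B.
Proof.
case=> symR symB irrR irrB RB neq nR nB; split=> //.
- by move=> x y; rewrite /add_edge symR [X in X || _ = _]orbC.
- by move=> x /add_edgeP[[? ?]|[? ?]|/irrR] //; congruence.
- move=> x y /add_edgeP[[-> ->]|[-> ->]|/RB] //.
  by rewrite symB.
Qed.

Definition no_triangle (E : rel nat) :=
  forall x y z, E x y -> E y z -> E z x -> False.

Lemma position_adj_sym p : symmetric (position_adj p).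
Proof. by move=> x y; apply: eq_has => m; rewrite orbC. Qed.

Lemma position_adj_colour p x y :
  position_adj p x y = colour_adj p true x y || colour_adj p false x y.
Proof.
elim: p => //= -[m c] p; rewrite /position_adj /colour_adj /= => ->.
by case: c; rewrite /= ?orbA //; congr orb; rewrite orbC orbA.
Qed.

Definition union (R B : rel nat) : rel nat := fun x y => R x y || B x y.

(** The strategies below look only at the red and the blue graph, and they use
    F-freeness only of the board that contains the new edge. *)
Lemma painter_wins_triangle (F : sgraph) (I : rel nat -> rel nat -> Prop) :
    I (fun _ _ => false) (fun _ _ => false) ->
    (forall R B, I R B -> no_triangle R /\ no_triangle B) ->
    (forall R B u v, colouring R B -> I R B ->
       u <> v -> ~ R u v -> ~ B u v ->
       ~ contains_copy (add_edge (u, v) (union R B)) F ->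
       I (add_edge (u, v) R) B \/ I R (add_edge (u, v) B)) ->
  painter_wins C3 (free_class F).
Proof.
move=> I0 Isafe Istep.
pose J p := colouring (colour_adj p true) (colour_adj p false)
  /\ I (colour_adj p true) (colour_adj p false).
apply: (@painter_wins_invariant C3 _ J).
- by split=> //; split.
- move=> p [u v] [colp Ip] [/= /eqP neq nadj free].
  rewrite position_adj_colour negb_or in nadj.
  case/andP: nadj => /negP nR /negP nB.
  have [] := Istep _ _ u v colp Ip neq nR nB.
  + move=> cF; apply: free; apply: contains_copy_mono cF => x y.
    by rewrite /union /add_edge -position_adj_colour.
  + by exists true; split=> //; apply: colouring_red.
  + exists false; split=> //; apply/colouring_swap/colouring_red=> //.
    exact: colouring_swap.
- move=> p [colp /Isafe[tR tB]] [c [f [injf Ef]]].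
  pose v0 : C3 := @Ordinal 3 0 isT; pose v1 : C3 := @Ordinal 3 1 isT.
  pose v2 : C3 := @Ordinal 3 2 isT.
  have [e01 e12 e20] : [/\ edge v0 v1, edge v1 v2 & edge v2 v0] by [].
  by case: c Ef => Ef; [apply: tR|apply: tB]; apply: Ef; eassumption.
Qed.

(** * Local configurations on a coloured board *)

Lemma union_sym R B : symmetric R -> symmetric B -> symmetric (union R B).
Proof. by move=> sR sB x y; rewrite /union sR sB. Qed.

Ltac saturate_sym := repeat match goal with
  | S : symmetric ?R, H : is_true (?R ?x ?y) |- _ =>
    lazymatch goal with
    | _ : is_true (R y x) |- _ => fail
    | _ => have ? : is_true (R y x) by rewrite S
    end
  end.

(** Adjacency tells vertices apart: after two of them are identified, an edge
    becomes a loop, has both colours, or closes a forbidden triangle. *)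
Ltac clash := solve [ exfalso; match goal with
  | irr : (forall x, is_true (?R x x) -> False), H : is_true (?R ?a ?a) |- _ =>
    exact: irr H
  | RB : (forall x y, is_true (?R x y) -> is_true (?B x y) -> False),
    H1 : is_true (?R ?a ?b), H2 : is_true (?B ?a ?b) |- _ => exact: RB H1 H2
  | N : ~ is_true (?R ?a ?b), H : is_true (?R ?a ?b) |- _ => exact: N H
  | T : no_triangle ?R, H1 : is_true (?R ?a ?b), H2 : is_true (?R ?b ?c),
    H3 : is_true (?R ?c ?a) |- _ => exact: T H1 H2 H3
  | _ => congruence
  end ].

Ltac distinct := let E := fresh in
  match goal with
  | |- is_true (?a != ?b) => apply/eqP => E
  | |- ?a <> ?b => move=> E
  end; subst; clash.

Definition clique (K : seq nat) : rel nat :=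
  fun a b => [&& a \in K, b \in K & a != b].

Lemma clique_sym K : symmetric (clique K).
Proof. by move=> a b; rewrite /clique eq_sym; case: (a \in K); case: (b \in K). Qed.

Ltac symmetry_of := repeat (assumption || apply: union_sym || apply: clique_sym).

Ltac adjacent := rewrite /union; first [
  match goal with
  | H : is_true (?R ?a ?b) |- is_true (?R ?a ?b || _) => by rewrite H
  | H : is_true (?R ?a ?b) |- is_true (_ || ?R ?a ?b) => by rewrite H orbT
  | H : is_true (?R ?a ?b) |- is_true ((?R ?a ?b || _) || _) => by rewrite H
  | H : is_true (?R ?a ?b) |- is_true ((_ || ?R ?a ?b) || _) =>
    by rewrite H orbT
  end |
  by rewrite /clique !inE !eqxx ?orbT /=; apply/orP; right; distinct ].

(** Here [l] lists the images of the vertices 0, 1, 2 and so on of the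
    pattern. *)
Ltac find_copy l :=
  saturate_sym; apply: (@contains_copy_seq _ _ _ l);
  [ symmetry_of | by [] |
    rewrite /= !inE !negb_or; repeat (apply/andP; split); try done; distinct |
    rewrite /=; repeat (apply/andP; split); try done; adjacent ].

Definition common_neighbour (R : rel nat) x y := exists w, R w x /\ R w y.
Definition two_neighbours (R : rel nat) x := exists p q, p <> q /\ R x p /\ R x q.
Definition path3 (R : rel nat) x y := exists p q, R x p /\ R p q /\ R q y.

Lemma common_neighbour_mono (R R' : rel nat) x y : (forall x y, R x y -> R' x y) ->
  common_neighbour R x y -> common_neighbour R' x y.
Proof. by move=> sub [w [/sub ? /sub ?]]; exists w. Qed.

Lemma two_neighbours_mono (R R' : rel nat) x : (forall x y, R x y -> R' x y) ->
  two_neighbours R x -> two_neighbours R' x.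
Proof. by move=> sub [p [q [? [/sub ? /sub ?]]]]; exists p, q. Qed.

Lemma path3_mono (R R' : rel nat) x y : (forall x y, R x y -> R' x y) ->
  path3 R x y -> path3 R' x y.
Proof. by move=> sub [p [q [/sub ? [/sub ? /sub ?]]]]; exists p, q. Qed.

Lemma common_neighbour_sym R x y : common_neighbour R x y -> common_neighbour R y x.
Proof. by case=> w []; exists w. Qed.

Lemma path3_sym R x y : symmetric R -> path3 R x y -> path3 R y x.
Proof. by move=> s [p [q [? [? ?]]]]; exists q, p; split; [|split]; rewrite s. Qed.

Ltac find_common_neighbour := match goal with
  |- common_neighbour ?R ?a ?b => match goal with
  H1 : is_true (R ?w a), H2 : is_true (R ?w b) |- _ => by exists w end end.
Ltac find_two_neighbours := match goal with |- two_neighbours ?R ?a => match goal with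
  H1 : is_true (R a ?p), H2 : is_true (R a ?q), N : ?p <> ?q |- _ =>
    by exists p, q end end.
Ltac find_path3 := match goal with |- path3 ?R ?a ?b => match goal with
  H1 : is_true (R a ?p), H2 : is_true (R ?p ?q), H3 : is_true (R ?q b) |- _ =>
    by exists p, q end end.

Lemma neighbour_other_than (R : rel nat) x w : two_neighbours R x -> exists2 p, R x p & p <> w.
Proof.
case=> p [q [pq [xp xq]]]; have [E|/eqP] := eqVneq p w; last by exists p.
by exists q => // qw; apply: pq; congruence.
Qed.

Lemma only_neighbour (R : rel nat) x p q :
  ~ two_neighbours R x -> R x p -> R x q -> p = q.
Proof. by move=> nt xp xq; apply: NNPP => pq; apply: nt; exists p, q. Qed.

Definition red_star (R : rel nat) w x y z :=
  [/\ R w x, R w y, R w z & [/\ x <> y, y <> z & x <> z]].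

Definition closed_under (E : rel nat) (K : seq nat) :=
  forall k t, k \in K -> E k t -> t \in K.

Definition has_exit (E : rel nat) (K : seq nat) :=
  exists2 k, k \in K & exists2 t, t \notin K & E k t.

Lemma has_exit_eq E K K' : K =i K' -> has_exit E K -> has_exit E K'.
Proof. by move=> eqK [k kK [t tK kt]]; exists k; rewrite -?eqK //; exists t; rewrite -?eqK. Qed.

Lemma closed_eq E K K' : K =i K' -> closed_under E K -> closed_under E K'.
Proof. by move=> eqK cl k t; rewrite -!eqK; apply: cl. Qed.

Lemma not_closed_exit E K : ~ closed_under E K -> has_exit E K.
Proof.
move=> nclosed; apply: NNPP => nl; apply: nclosed => k t kK kt.
by apply/idPn => tK; apply: nl; exists k => //; exists t.
Qed.

Lemma eq_or_neq (r p q : nat) : (r = p \/ r = q) \/ (r <> p /\ r <> q).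
Proof. by case: (r =P p) => ?; case: (r =P q) => ?; tauto. Qed.

(** * The game on X1-free graphs *)

(** A red edge xy would give a red vertex of degree three, a red triangle or a
    red 4-cycle.  As this property is monotone in the red graph, it remains true
    of an edge that was coloured blue because of it, and the order of play can
    be forgotten. *)
Definition blocked R x y :=
  [\/ two_neighbours R x, two_neighbours R y, common_neighbour R x y
    | path3 R x y].

Definition max_deg2 (R : rel nat) := forall w x y z, R w x -> R w y -> R w z ->
  x <> y -> y <> z -> x <> z -> False.

Definition no_square (R : rel nat) := forall x p y q, x <> y -> p <> q ->
  R x p -> R p y -> R y q -> R q x -> False.

Section X1.
Variables R B : rel nat.
Hypotheses (col : colouring R B) (tri : no_triangle R) (deg : max_deg2 R).
Hypotheses (sq : no_square R) (rea : forall x y, B x y -> blocked R x y).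
Hypothesis free : ~ contains_copy (union R B) X1.

Let symR := red_sym col.
Let symB := blue_sym col.
Let irrR := red_irr col.
Let irrB := blue_irr col.
Let RB := red_blue col.

(** A red neighbour of y that is not one of x, together with two red neighbours
    of x, yields the three leaves of X1.  Without such a neighbour x and y are
    opposite on a red 4-cycle. *)
Lemma X1_two_two x y z : B x y -> B y z -> B z x ->
  two_neighbours R x -> two_neighbours R y -> False.
Proof.
move=> xy yz zx [p [q [pq [xp xq]]]] [r [s [rs [yr ys]]]].
have [rp|/eqP rp] := eqVneq r p; last have [rq|/eqP rq] := eqVneq r q.
- have [sq'|/eqP sq'] := eqVneq s q.
    by subst; saturate_sym; apply: (sq (x := x) (y := y) _ pq xp); try done; distinct.
  by subst; apply: free; find_copy [:: x; y; z; p; q; s].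
- have [sp|/eqP sp] := eqVneq s p.
    by subst; saturate_sym; apply: (sq (x := x) (y := y) _ pq xp); try done; distinct.
  by subst; apply: free; find_copy [:: x; y; z; p; q; s].
- by apply: free; find_copy [:: x; y; z; p; q; r].
Qed.

(** Two red neighbours of x are the two leaves at one corner of X1, and
    whatever blocks the opposite edge yz supplies the leaf at another corner. *)
Lemma X1_two x y z : B x y -> B y z -> B z x -> two_neighbours R x -> False.
Proof.
move=> xy yz zx tx; have [] := rea yz.
- exact: (X1_two_two xy yz zx tx).
- by move=> tz; exact: (X1_two_two zx xy yz tz tx).
- case: tx => p [q [pq [xp xq]]] [w [wy wz]].
  have [wp|/eqP wp] := eqVneq w p.
    by subst; saturate_sym;
      apply: (deg (w := p) (x := x) (y := y) (z := z)); try done; distinct.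
  have [wq|/eqP wq] := eqVneq w q.
    by subst; saturate_sym;
      apply: (deg (w := q) (x := x) (y := y) (z := z)); try done; distinct.
  by apply: free; find_copy [:: x; y; z; p; q; w].
- case: tx => p [q [pq [xp xq]]] [r [s [yr [rs sz]]]].
  have [rp|/eqP rp] := eqVneq r p.
    by subst; saturate_sym;
      apply: (deg (w := p) (x := x) (y := y) (z := s)); try done; distinct.
  have [rq|/eqP rq] := eqVneq r q.
    by subst; saturate_sym;
      apply: (deg (w := q) (x := x) (y := y) (z := s)); try done; distinct.
  by apply: free; find_copy [:: x; y; z; p; q; r].
Qed.

(** If no corner has two red neighbours, then the middle vertex of the red path
    from x to y is the only red neighbour of x.  Hence it also lies on the red
    path that blocks zx, where it gets a third red neighbour. *)
Lemma X1_common x y z : B x y -> B y z -> B z x -> common_neighbour R x y -> False.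
Proof.
move=> xy yz zx [w [wx wy]].
have ntx : ~ two_neighbours R x by apply: X1_two xy yz zx.
have [|//|[v [vz vx]]|[p [q [zp [pq qx]]]]] := rea zx.
- exact: (X1_two zx xy yz).
- have E : v = w by apply: (only_neighbour ntx); rewrite symR.
  by subst; apply: (deg wx wy vz); distinct.
- have E : q = w by apply: (only_neighbour ntx); rewrite symR.
  by subst; saturate_sym;
      apply: (deg (w := w) (x := x) (y := y) (z := p)); try done; distinct.
Qed.

(** What remains are red paths of length three between the corners.  The two
    paths from x share their first edge xp; if they part at p then p has three
    red neighbours, and otherwise their next vertex has. *)
Lemma X1_no_blue_triangle : no_triangle B.
Proof.
move=> x y z xy yz zx.
have pathP a b c : B a b -> B b c -> B c a -> path3 R a b.
  move=> ab bc ca; have [||/(X1_common ab bc ca)|] // := rea ab.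
    by move/(X1_two ab bc ca).
  by move/(X1_two bc ca ab).
have ntx : ~ two_neighbours R x by apply: X1_two xy yz zx.
have [p [q [xp [pq qy]]]] := pathP _ _ _ xy yz zx.
have [s [r [zs [sr rx]]]] := pathP _ _ _ zx xy yz.
have E : r = p by apply: (only_neighbour ntx); rewrite 1?symR // symR.
subst r; have [E|/eqP sq'] := eqVneq s q.
  by subst; saturate_sym;
      apply: (deg (w := q) (x := p) (y := y) (z := z)); try done; distinct.
by saturate_sym; apply: (deg (w := p) (x := x) (y := q) (z := s)); try done; distinct.
Qed.
End X1.

Definition X1_invariant R B :=
  [/\ no_triangle R, no_triangle B, max_deg2 R, no_square R
    & forall x y, B x y -> blocked R x y].

Lemma painter_wins_X1 : painter_wins C3 (free_class X1).
Proof.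
apply: (painter_wins_triangle (I := X1_invariant)) =>
  [|R B []|R B u v col [tR tB deg sq rea] uv nR nB free] //.
have [re|nre] := classic (blocked R u v); [right|left].
- have col' : colouring R (add_edge (u, v) B).
    by apply/colouring_swap/colouring_red => //; apply: colouring_swap.
  have rea' x y : add_edge (u, v) B x y -> blocked R x y.
    case/add_edgeP => [[-> ->]|[-> ->]|/rea] //.
    case: re => ?; [constructor 2|constructor 1|constructor 3|constructor 4] => //.
      exact: common_neighbour_sym.
    apply: path3_sym => //; exact: red_sym col.
  split=> //; apply: (X1_no_blue_triangle col') => //.
  move=> cF; apply: free; apply: contains_copy_mono cF => x y.
  by rewrite /union /add_edge orbCA.
- have col' := colouring_red col uv nR nB.
  case: col col' => sR sB iR iB RB [sR' _ iR' _ RB'].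
  split=> //.
  + move=> x y z /add_edgeP[[? ?]|[? ?]|xy] /add_edgeP[[? ?]|[? ?]|yz]
      /add_edgeP[[? ?]|[? ?]|zx]; subst; try clash; saturate_sym; apply: nre;
      by constructor 3; find_common_neighbour.
  + move=> w x y z /add_edgeP[[? ?]|[? ?]|wx] /add_edgeP[[? ?]|[? ?]|wy]
      /add_edgeP[[? ?]|[? ?]|wz] xny ynz xnz; subst; try clash;
      try exact: deg wx wy wz xny ynz xnz; apply: nre;
      by [constructor 1; find_two_neighbours | constructor 2; find_two_neighbours].
  + move=> x p y q xny pnq /add_edgeP[[? ?]|[? ?]|xp] /add_edgeP[[? ?]|[? ?]|py]
      /add_edgeP[[? ?]|[? ?]|yq] /add_edgeP[[? ?]|[? ?]|qx]; subst; try clash;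
      try exact: sq xny pnq xp py yq qx; saturate_sym; apply: nre;
      by constructor 4; find_path3.
  + have sub x y := @add_edge_sub (u, v) R x y.
    move=> x y /rea[] re; [constructor 1|constructor 2|constructor 3|constructor 4].
    * exact: two_neighbours_mono re.
    * exact: two_neighbours_mono re.
    * exact: common_neighbour_mono re.
    * exact: path3_mono re.
Qed.

(** * The games on X3-free and on X4-free graphs *)

(** A red edge ab would complete a red star with three leaves at a, with no
    further edge at its centre a or at its leaf b. *)
Definition third_leaf (R B : rel nat) a b :=
  (forall t, ~ union R B b t) /\
  exists p q, [/\ p <> q, R a p, R a q &
                  forall t, union R B a t -> t = p \/ t = q].

(** In the fourth clause the first disjunction serves X3 and the second one X4.
    It holds for two blue edges at z because at the moment when an edge is drawn
    as a third leaf, its isolated end has no other edge and its other end has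
    only red ones.  The last clause rules out the K4 that is a component. *)
Definition diamond_invariant R B :=
  [/\ no_triangle R, no_triangle B,
      forall z x, B z x ->
        [\/ common_neighbour R z x, two_neighbours R z | two_neighbours R x],
      forall z x y, B z x -> B z y -> x <> y ->
        (common_neighbour R z x \/ two_neighbours R x \/
         common_neighbour R z y \/ two_neighbours R y) /\
        (common_neighbour R z x \/ common_neighbour R z y \/ two_neighbours R z)
    & forall w x y z, red_star R w x y z ->
        has_exit (union R B) [:: w; x; y; z]].

Section Diamond.
Variables R B B' : rel nat.
Hypotheses (col : colouring R B') (good : diamond_invariant R B).
Hypothesis sub : forall x y, B x y -> B' x y.

Let symR := red_sym col.
Let symB := blue_sym col.
Let irrR := red_irr col.
Let irrB := blue_irr col.
Let RB := red_blue col.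

Variables x y z w : nat.
Hypotheses (xy : B' x y) (zx : B z x) (zy : B z y) (wx : R w x) (wy : R w y).

(** An edge that leaves a K4 is a pendant edge both at a vertex of degree three
    and at a vertex of degree two of suitable copies of K4 minus an edge. *)
Lemma K4_exit : R w z ->
  contains_copy (union R B') X3 /\ contains_copy (union R B') X4.
Proof.
move=> wz; have /sub zx' := zx; have /sub zy' := zy; have [_ _ _ _ st] := good.
have [k] : has_exit (union R B) [:: w; x; y; z].
  by apply: st; split=> //; split; distinct.
rewrite !inE => kK [t]; rewrite !inE !negb_or => /and4P[/eqP tw /eqP tx /eqP ty /eqP tz].
have {kK} : [\/ k = w, k = x, k = y | k = z].
  by case/or4P: kK => /eqP->; [constructor 1|constructor 2|constructor 3|constructor 4].
by case=> -> /orP[kt|/sub kt]; split;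
  [ find_copy [:: w; x; y; z; t] | find_copy [:: x; y; w; z; t]
  | find_copy [:: w; x; y; z; t] | find_copy [:: x; y; w; z; t]
  | find_copy [:: x; w; y; z; t] | find_copy [:: w; y; x; z; t]
  | find_copy [:: x; w; y; z; t] | find_copy [:: w; y; x; z; t]
  | find_copy [:: y; x; w; z; t] | find_copy [:: x; w; y; z; t]
  | find_copy [:: y; x; w; z; t] | find_copy [:: x; w; y; z; t]
  | find_copy [:: z; x; y; w; t] | find_copy [:: x; y; z; w; t]
  | find_copy [:: z; x; y; w; t] | find_copy [:: x; y; z; w; t] ].
Qed.

(** The vertices w and z form a diamond with the edge xy in the middle.  If zx
    is blue because of a red common neighbour of z and x or because x has two
    red neighbours, there is a pendant edge at x; likewise for y. *)
Lemma diamond_X3 : contains_copy (union R B') X3.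
Proof.
have [/K4_exit[] //|/negP nwz] := boolP (R w z).
have /sub zx' := zx; have /sub zy' := zy; have [_ _ _ adj _] := good.
have xny : x <> y by distinct.
have [[[v [vz vx]]|[tx|[[v [vz vy]]|ty]]] _] := adj _ _ _ zx zy xny.
- by find_copy [:: x; y; z; w; v].
- by have [p xp pw] := neighbour_other_than w tx; find_copy [:: x; y; z; w; p].
- by find_copy [:: y; x; z; w; v].
- by have [p yp pw] := neighbour_other_than w ty; find_copy [:: y; x; z; w; p].
Qed.

(** The same diamond, now with a pendant edge at its corner z. *)
Lemma diamond_X4 : contains_copy (union R B') X4.
Proof.
have [/K4_exit[] //|/negP nwz] := boolP (R w z).
have /sub zx' := zx; have /sub zy' := zy; have [_ _ _ adj _] := good.
have xny : x <> y by distinct.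
have [_ [[v [vz vx]]|[[v [vz vy]]|tz]]] := adj _ _ _ zx zy xny.
- by find_copy [:: x; y; z; w; v].
- by find_copy [:: x; y; z; w; v].
- by have [p zp pw] := neighbour_other_than w tz; find_copy [:: x; y; z; w; p].
Qed.

End Diamond.

(** If z is isolated then w has a further edge, for otherwise wz would have been
    a third leaf.  If z is adjacent to x then zx is blue, and its reason to be
    blue provides an edge that leaves the star. *)
Lemma new_star_exit R B w x y z :
    colouring R B -> diamond_invariant R B -> R w x -> R w y -> x <> y -> y <> z -> x <> z ->
    w <> z -> ~ R w z -> ~ B w z -> ~ common_neighbour R w z -> ~ third_leaf R B w z ->
  has_exit (union R B) [:: w; x; y; z].
Proof.
move=> [symR symB irrR irrB RB] [tR _ rea _ _] wx wy xy yz xz wz nR nB ncom nthird.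
have key a b : R w a -> R w b -> a <> b -> a <> z -> b <> z -> union R B z a ->
    has_exit (union R B) [:: w; a; b; z].
  move=> wa wb ab az bz /orP[za|za].
    by case: ncom; saturate_sym; exists a.
  have [[s [sz sa]]|/(neighbour_other_than b)[p zp pb]|/(neighbour_other_than w)[p ap pw]] := rea _ _ za.
  - exists z; first by rewrite !inE eqxx !orbT.
    exists s; last by rewrite /union symR sz.
    by saturate_sym; rewrite !inE !negb_or; do ! (apply/andP; split); distinct.
  - exists z; first by rewrite !inE eqxx !orbT.
    exists p; last by rewrite /union zp.
    by saturate_sym; rewrite !inE !negb_or; do ! (apply/andP; split); distinct.
  - exists a; first by rewrite !inE eqxx !orbT.
    exists p; last by rewrite /union ap.
    by saturate_sym; rewrite !inE !negb_or; do ! (apply/andP; split); distinct.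
have [[t zt]|iso] := classic (exists t, union R B z t).
- have [tx|/eqP tx] := eqVneq t x; first by subst; apply: key.
  have [ty|/eqP ty] := eqVneq t y.
    by subst; apply: (has_exit_eq (K := [:: w; y; x; z])) => [k|];
       [rewrite !inE; do ! case: eqP | apply: key; auto].
  exists z; first by rewrite !inE eqxx !orbT.
  exists t => //; saturate_sym; case/orP: zt => zt; saturate_sym;
    by rewrite !inE !negb_or; do ! (apply/andP; split); distinct.
- have [[t wt [tx ty]]|full] :=
    classic (exists2 t, union R B w t & t <> x /\ t <> y).
    exists w; first by rewrite !inE eqxx.
    exists t => //; case/orP: wt => wt;
    by rewrite !inE !negb_or; do ! (apply/andP; split); distinct.
  case: nthird; split=> [t zt|]; first by apply: iso; exists t.
  exists x, y; split=> // t wt; apply: NNPP => /not_or_and ?.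
  by apply: full; exists t.
Qed.

Lemma painter_wins_diamond F :
  (forall R B B' x y z w, colouring R B' -> diamond_invariant R B ->
     (forall x y, B x y -> B' x y) ->
     B' x y -> B z x -> B z y -> R w x -> R w y ->
     contains_copy (union R B') F) ->
  painter_wins C3 (free_class F).
Proof.
move=> diam.
apply: (painter_wins_triangle (I := diamond_invariant)) =>
  [|R B []|R B u v col good uv nR nB free] //.
  by split=> // w x y z [].
have [tR tB rea adj star] := good.
have [re|nre] := classic [\/ common_neighbour R u v, third_leaf R B u v | third_leaf R B v u];
  [right|left].
- have col' : colouring R (add_edge (u, v) B).
    by apply/colouring_swap/colouring_red => //; apply: colouring_swap.
  have sub x y : B x y -> add_edge (u, v) B x y := @add_edge_sub (u, v) B x y.
  have free' : ~ contains_copy (union R (add_edge (u, v) B)) F.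
    move=> cF; apply: free; apply: contains_copy_mono cF => x y.
    by rewrite /union /add_edge orbCA.
  have [symR symB irrR irrB RB] := col.
  have nbr z : B z u -> B z v -> False.
    move=> zu zv; case: re => [[w [wu wv]]|[iso _]|[iso _]].
    + apply: free'; apply: (diam R B _ u v z w) => //; exact: add_edge_new.
    + by apply: (iso z); rewrite /union symB zv orbT.
    + by apply: (iso z); rewrite /union symB zu orbT.
  have third2 a b : third_leaf R B a b -> two_neighbours R a.
    by case=> _ [p [q []]]; exists p, q.
  split=> //.
  + move=> x y z /add_edgeP[[? ?]|[? ?]|xy] /add_edgeP[[? ?]|[? ?]|yz]
      /add_edgeP[[? ?]|[? ?]|zx]; subst; try clash; saturate_sym; eauto.
  + move=> z x /add_edgeP[[-> ->]|[-> ->]|/rea] //.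
      by case: re => [?|/third2 ?|/third2 ?]; [constructor 1|constructor 2|constructor 3].
    by case: re => [/common_neighbour_sym ?|/third2 ?|/third2 ?]; [constructor 1|constructor 3|constructor 2].
  + have third_nbr a b x : third_leaf R B a b -> B a x -> False.
      move=> [_ [p [q [_ ap aq full]]]] ax.
      have [] : x = p \/ x = q by apply: full; rewrite /union ax orbT.
        by move=> E; subst; clash.
      by move=> E; subst; clash.
    have leaf_nbr a b x : third_leaf R B a b -> B b x -> False.
      by move=> [iso _] bx; apply: (iso x); rewrite /union bx orbT.
    have newu x : B u x -> common_neighbour R u v.
      by move=> ux; case: re => // [/third_nbr|/leaf_nbr] /(_ _ ux).
    have newv x : B v x -> common_neighbour R v u.
      move=> vx; case: re => [/common_neighbour_sym //|/leaf_nbr|/third_nbr] /(_ _ vx) //.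
    move=> z x y /add_edgeP[[? ?]|[? ?]|zx] /add_edgeP[[? ?]|[? ?]|zy] xny;
      subst; try clash.
    * by have := newu _ zy; tauto.
    * by have := newv _ zy; tauto.
    * by have := newu _ zx; tauto.
    * by have := newv _ zx; tauto.
    * exact: adj.
  + move=> w x y z /star[k kK [t tK kt]]; exists k => //; exists t => //.
    by case/orP: kt => [|/sub]; rewrite /union => ->; rewrite ?orbT.
- have col' := colouring_red col uv nR nB.
  have sub x y : R x y -> add_edge (u, v) R x y := @add_edge_sub (u, v) R x y.
  have subU x y : union R B x y -> union (add_edge (u, v) R) B x y.
    by rewrite /union => /orP[/sub|] ->; rewrite ?orbT.
  have exitU K : has_exit (union R B) K -> has_exit (union (add_edge (u, v) R) B) K.
    by move=> [k kK [t tK /subU kt]]; exists k => //; exists t.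
  have [symR symB irrR irrB RB] := col.
  have ncom : ~ common_neighbour R u v by move=> ?; apply: nre; constructor 1.
  have new w x y z : R w x -> R w y -> x <> y -> y <> z -> x <> z ->
      w = u /\ z = v \/ w = v /\ z = u ->
      has_exit (union (add_edge (u, v) R) B) [:: w; x; y; z].
    move=> wx wy xny ynz xnz E; apply: exitU; apply: new_star_exit => //.
    - by case: E => [[-> ->]|[-> ->]] // ?; apply: uv.
    - by case: E => [[-> ->]|[-> ->]] //; rewrite symR.
    - by case: E => [[-> ->]|[-> ->]] //; rewrite symB.
    - by case: E => [[-> ->]|[-> ->]] // /common_neighbour_sym.
    - by case: E => [[-> ->]|[-> ->]] ?; apply: nre; [constructor 2|constructor 3].
  split=> //.
  + move=> x y z /add_edgeP[[? ?]|[? ?]|xy] /add_edgeP[[? ?]|[? ?]|yz]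
      /add_edgeP[[? ?]|[? ?]|zx]; subst; try clash; saturate_sym; apply: ncom;
      find_common_neighbour.
  + move=> z x /rea[] re; [constructor 1|constructor 2|constructor 3].
    * exact: common_neighbour_mono re.
    * exact: two_neighbours_mono re.
    * exact: two_neighbours_mono re.
  + move=> z x y zx zy xny; have [re1 re2] := adj _ _ _ zx zy xny.
    have mc := @common_neighbour_mono _ _ _ _ sub; have mt := @two_neighbours_mono _ _ _ sub.
    by split; [case: re1 => [/mc|[/mt|[/mc|/mt]]] | case: re2 => [/mc|[/mc|/mt]]]; tauto.
  + move=> w x y z [/add_edgeP wx /add_edgeP wy /add_edgeP wz [xny ynz xnz]].
    have permx : [:: w; y; z; x] =i [:: w; x; y; z].
      by move=> k; rewrite !inE; do ! case: eqP.
    have permy : [:: w; x; z; y] =i [:: w; x; y; z].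
      by move=> k; rewrite !inE; do ! case: eqP.
    case: wx wy wz => [[? ?]|[? ?]|wx] [[? ?]|[? ?]|wy] [[? ?]|[? ?]|wz]; subst; try clash.
    all: try (by apply: new; auto).
    all: try (by apply: (has_exit_eq permx); apply: new; auto).
    all: try (by apply: (has_exit_eq permy); apply: new; auto).
    by apply/exitU/star.
Qed.

Lemma painter_wins_X3 : painter_wins C3 (free_class X3).
Proof. by apply: painter_wins_diamond => *; apply: diamond_X3; eassumption. Qed.

Lemma painter_wins_X4 : painter_wins C3 (free_class X4).
Proof. by apply: painter_wins_diamond => *; apply: diamond_X4; eassumption. Qed.

(** * The game on X2-free graphs *)

(** As X2 is connected and has six vertices, edges added
    within a union of components on at most five vertices create no copy. *)
Lemma X2_copy_avoids_closed (E : rel nat) (W K : seq nat) :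
  symmetric E -> size W <= 5 -> closed_under E W -> {subset K <= W} ->
  contains_copy (union E (clique K)) X2 -> contains_copy E X2.
Proof.
move=> symE sW clW KW [f [injf Ef]].
pose v k ltk : X2 := @Ordinal 6 k ltk.
pose S i := f i \in W.
have step i j : edge i j -> S i = S j.
  move=> e; apply/idP/idP => Si.
    by have /orP[/(clW _ _ Si)|/and3P[_ /KW]] := Ef _ _ e.
  have /orP[|/and3P[/KW]] := Ef _ _ e => //.
  by rewrite symE => /(clW _ _ Si).
have S2 (i : X2) : S i = S (@Ordinal 6 2 isT).
  have e20 : edge (v 2 isT) (v 0 isT) by [].
  have e21 : edge (v 2 isT) (v 1 isT) by [].
  have e23 : edge (v 2 isT) (v 3 isT) by [].
  have e34 : edge (v 3 isT) (v 4 isT) by [].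
  have e35 : edge (v 3 isT) (v 5 isT) by [].
  rewrite -[Ordinal _]/(v 2 isT).
  case: i => [[|[|[|[|[|[|//]]]]]] lt6].
  - by rewrite (step _ _ e20); congr S; apply: val_inj.
  - by rewrite (step _ _ e21); congr S; apply: val_inj.
  - by congr S; apply: val_inj.
  - by rewrite (step _ _ e23); congr S; apply: val_inj.
  - by rewrite (step _ _ e23) (step _ _ e34); congr S; apply: val_inj.
  - by rewrite (step _ _ e23) (step _ _ e35); congr S; apply: val_inj.
have [inW|outW] := boolP (S (@Ordinal 6 2 isT)).
  have : size (codom f) <= size W.
    apply: uniq_leq_size; first by rewrite map_inj_uniq ?enum_uniq.
    by move=> _ /codomP[i ->]; rewrite -/(S i) S2.
  by rewrite size_codom card_ord => /leq_trans/(_ sW).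
exists f; split=> // i j /Ef /orP[//|/and3P[/KW fi _ _]].
by case/negP: outW; rewrite -(S2 i).
Qed.

(** A red edge wz would complete a red star with three leaves that Builder might
    extend to a K4 on the same vertices. *)
Definition star_threat (E R : rel nat) w z :=
  exists x y, [/\ x <> y, R w x, R w y &
                  ~ contains_copy (union E (clique [:: w; x; y; z])) X2].

(** A red edge xy would close a red 4-cycle in a component that lies within five
    vertices.  Playing all edges on these five vertices is legal for Builder,
    and a colouring of them without monochromatic triangles has no
    monochromatic 4-cycle. *)
Definition square_threat (E R : rel nat) x y :=
  exists p q s, [/\ R x p, R p q, R q y & closed_under E [:: x; y; p; q; s]].

(** The fourth clause limits the blue answers: two blue edges zx and zy of a
    potential blue triangle do not both owe their colour to red edges away from
    z.  The last two clauses survive later moves because copies of X2 and edges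
    that leave a set do. *)
Definition X2_invariant R B :=
  [/\ no_triangle R, no_triangle B, forall x y, B x y -> blocked R x y,
      forall z x y, B z x -> B z y -> x <> y -> ~ R x y ->
        [\/ common_neighbour R z x, common_neighbour R z y | two_neighbours R z]
    & (forall w x y z, red_star R w x y z ->
        contains_copy (union (union R B) (clique [:: w; x; y; z])) X2) /\
      (forall x p y q s, x <> y -> p <> q -> R x p -> R p y -> R y q -> R q x ->
        ~ closed_under (union R B) [:: x; y; p; q; s])].

Section BlueTriangle.
Variables R B : rel nat.
Hypotheses (col : colouring R B) (triR : no_triangle R).
Hypothesis rea : forall x y, B x y -> blocked R x y.
Hypothesis adj : forall z x y, B z x -> B z y -> x <> y -> ~ R x y ->
  [\/ common_neighbour R z x, common_neighbour R z y | two_neighbours R z].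
Hypothesis star : forall w x y z, red_star R w x y z ->
  contains_copy (union (union R B) (clique [:: w; x; y; z])) X2.
Hypothesis free : ~ contains_copy (union R B) X2.

Let symR := red_sym col.
Let symB := blue_sym col.
Let irrR := red_irr col.
Let irrB := blue_irr col.
Let RB := red_blue col.

(** The K4 on w, x, y, z is present, so the copy of X2 that the invariant finds
    after adding it was there before. *)
Lemma X2_no_apex w x y z : B x y -> B y z -> B z x ->
  R w x -> R w y -> R w z -> False.
Proof.
move=> xy yz zx wx wy wz; apply: free.
have := star (w := w) (x := x) (y := y) (z := z).
case; first by split=> //; split; distinct.
move=> f [injf Ef]; exists f; split=> // i j /Ef /orP[//|/and3P[]].
saturate_sym; rewrite /union !inE.
by do 2 (case/or4P; move/eqP->); rewrite ?eqxx // => _; apply/orP; (left; assumption) || (right; assumption).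
Qed.

(** The triangle y, z, w is joined by the edge xy to x, whose two red neighbours
    are the leaves of X2. *)
Lemma X2_common_two x y z : B x y -> B y z -> B z x ->
  common_neighbour R y z -> two_neighbours R x -> False.
Proof.
move=> xy yz zx [w [wy wz]] [p [q [pq [xp xq]]]].
have [E|/eqP wp] := eqVneq w p.
  by subst; apply: (X2_no_apex xy yz zx _ wy wz); rewrite symR.
have [E|/eqP wq] := eqVneq w q.
  by subst; apply: (X2_no_apex xy yz zx _ wy wz); rewrite symR.
by apply: free; find_copy [:: w; z; y; x; p; q].
Qed.

Lemma X2_common_common x y z : B x y -> B y z -> B z x ->
  common_neighbour R x y -> common_neighbour R x z -> two_neighbours R x.
Proof.
move=> xy yz zx [w [wx wy]] [v [vx vz]].
have [E|/eqP wv] := eqVneq w v.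
  by subst; case: (X2_no_apex xy yz zx wx wy vz).
by exists w, v; rewrite !(symR x).
Qed.

(** The edge yz would have to be blue because of a red path of length three.  Its
    inner vertices are the only red neighbours of y and of z, which are the
    middle vertices of the red paths from x; together with x they form a red
    triangle. *)
Lemma X2_common2 x y z : B x y -> B y z -> B z x ->
  common_neighbour R x y -> common_neighbour R x z -> False.
Proof.
move=> xy yz zx cxy cxz.
have nty : ~ two_neighbours R y by apply: (X2_common_two yz zx xy); apply: common_neighbour_sym.
have ntz : ~ two_neighbours R z by apply: (X2_common_two zx xy yz).
have tx := X2_common_common xy yz zx cxy cxz.
have [//|//|cyz|[p [q [yp [pq qz]]]]] := rea yz.
  exact: X2_common_two xy yz zx cyz tx.
case: cxy cxz => [w [wx wy]] [v [vx vz]].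
have E : p = w by apply: (only_neighbour nty); rewrite // symR.
have E' : q = v by apply: (only_neighbour ntz); rewrite symR.
by subst; saturate_sym; clash.
Qed.

(** The only blue triangles that survive have two red neighbours at every
    corner and no red path of length two between corners; they are excluded by
    the reason for the colour of the last edge. *)
Lemma X2_blue_triangle x y z : B x y -> B y z -> B z x ->
  [/\ two_neighbours R x, two_neighbours R y, two_neighbours R z & ~ common_neighbour R x y].
Proof.
move=> xy yz zx.
have xny : x <> y by distinct.
have ynz : y <> z by distinct.
have znx : z <> x by distinct.
have ncxy a b c : B a b -> B b c -> B c a -> ~ common_neighbour R a b.
  move=> ab bc ca cab.
  have aNb : a <> b by distinct.
  have nRab : ~ R a b by move=> ?; clash.
  have bc' : B c b by rewrite symB.
  have [cca|ccb|tc] := adj ca bc' aNb nRab.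
  - by apply: (X2_common2 ab bc ca cab); apply: common_neighbour_sym.
  - by apply: (X2_common2 (x := b) (y := a) (z := c)); rewrite 1?symB //; apply: common_neighbour_sym.
  - exact: (X2_common_two ca ab bc cab tc).
have two' a b c : B a b -> B b c -> B c a -> two_neighbours R a.
  move=> ab bc ca.
  have bNc : b <> c by distinct.
  have nRbc : ~ R b c by move=> ?; clash.
  have ac : B a c by rewrite symB.
  have [/(ncxy _ _ _ ab bc ca)//|/common_neighbour_sym/(ncxy _ _ _ ca ab bc)//|//] := adj ab ac bNc nRbc.
by split; [exact: two' xy yz zx|exact: two' yz zx xy|exact: two' zx xy yz|exact: ncxy xy yz zx].
Qed.

End BlueTriangle.

Definition X2_blue_move (R B : rel nat) u v :=
  let E := union R B in
  [\/ common_neighbour R u v, star_threat E R u v, star_threat E R v u | square_threat E R u v].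

Lemma square_threat_sym E R u v : symmetric R ->
  square_threat E R u v -> square_threat E R v u.
Proof.
move=> symR [p [q [s [up pq qv cl]]]]; saturate_sym.
exists q, p, s; split=> // k t kK kt.
have eqK : [:: v; u; q; p; s] =i [:: u; v; p; q; s].
  by move=> i; rewrite !inE; do ! case: eqP.
by rewrite eqK; apply: cl kt; rewrite -eqK.
Qed.

Section NewPair.
Variables R B : rel nat.
Hypotheses (col : colouring R B) (good : X2_invariant R B).
Hypothesis free : ~ contains_copy (union R B) X2.

Let symR := red_sym col.
Let symB := blue_sym col.
Let irrR := red_irr col.
Let irrB := blue_irr col.
Let RB := red_blue col.

Variables x y z : nat.
Hypotheses (zx : B z x) (xy : x <> y) (zy : z <> y) (nR : ~ R x y).
Hypotheses (nRzy : ~ R z y) (nBzy : ~ B z y).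

Let conclusion := [\/ common_neighbour R z x, common_neighbour R z y | two_neighbours R z].

(** If zx is blue because x has two red neighbours, these and the K4 on
    y, r, s, z form a copy of X2 unless they are r and s.  Then x, r, y, s is a
    red 4-cycle, so that some edge leaves the five vertices, and wherever it
    starts it completes a copy of X2.  A red path of length three from z to x
    gives z two neighbours outside the K4, again completing X2. *)
Lemma star_pair : star_threat (union R B) R y z -> conclusion.
Proof.
case=> r [s [rs yr ys noX2]].
have [triR _ rea _ [_ square]] := good.
have [tz|[p [q [pq [xp xq]]]]|c|[a [b [za [ab bx]]]]] := rea _ _ zx.
- by constructor 3.
- have [rp|[rp rq]] := eq_or_neq r p q; last first.
    by case: noX2; find_copy [:: y; r; z; x; p; q].
  have [sp|[sp sq]] := eq_or_neq s p q; last first.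
    by case: noX2; find_copy [:: y; s; z; x; p; q].
  have [xr xs] : R x r /\ R x s by split; [case: rp => -> | case: sp => ->].
  have : ~ closed_under (union R B) [:: x; y; r; s; z].
    by apply: square => //; rewrite symR.
  case/not_closed_exit => k kK [t]; rewrite !inE !negb_or.
  case/and5P => /eqP tx /eqP ty /eqP tr /eqP ts /eqP tz kt.
  clear p q rp sp xp xq pq; case: noX2; move: kK kt; rewrite !inE.
  case/orP=> [/eqP->|/orP[/eqP->|/orP[/eqP->|/orP[]/eqP->]]] /orP[kt|kt].
  + by find_copy [:: y; s; r; x; t; z].
  + by find_copy [:: y; s; r; x; t; z].
  + by find_copy [:: x; z; r; y; t; s].
  + by find_copy [:: x; z; r; y; t; s].
  + by find_copy [:: s; z; y; r; t; x].
  + by find_copy [:: s; z; y; r; t; x].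
  + by find_copy [:: r; z; y; s; t; x].
  + by find_copy [:: r; z; y; s; t; x].
  + by find_copy [:: r; s; y; z; t; x].
  + by find_copy [:: r; s; y; z; t; x].
- by constructor 1.
- have [ar|/eqP ar] := eqVneq a r.
    by subst; saturate_sym; constructor 2; exists r.
  have [as'|/eqP as'] := eqVneq a s.
    by subst; saturate_sym; constructor 2; exists s.
  by case: noX2; find_copy [:: r; s; y; z; x; a].
Qed.

(** All edges at x and z lie within the five vertices z, y, a, b, x.  The
    alternative to the three conclusions is a red star with centre b and leaves
    a, y, x, and the copy of X2 that belongs to it does not fit. *)
Lemma square_pair : square_threat (union R B) R z y -> conclusion.
Proof.
case=> a [b [s [za ab bay cl]]].
have [triR _ rea _ [star _]] := good.
have [tz|ntz] := classic (two_neighbours R z); first by constructor 3.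
have xs : x = s.
  have : x \in [:: z; y; a; b; s] by apply: (cl z); rewrite ?inE ?eqxx // /union zx orbT.
  by saturate_sym; rewrite !inE; do 4 (case/orP; first by move/eqP=> E; subst; clash); move/eqP.
subst s.
have nbr t : R x t -> t = a \/ t = b.
  move=> xt; have : t \in [:: z; y; a; b; x].
    by apply: (cl x); rewrite ?inE ?eqxx ?orbT // /union xt.
  saturate_sym; rewrite !inE; do 2 (case/orP; first by move/eqP=> E; subst; clash).
  by case/or3P=> /eqP E; auto; subst; clash.
have [//|[p [q [pq [xp xq]]]]|c|[c [d [zc [cd dx]]]]] := rea _ _ zx.
- constructor 1; exists a; split; first by rewrite symR.
  rewrite symR; have [E|E] := nbr _ xp; first by subst.
  by have [E'|E'] := nbr _ xq; subst.
- by constructor 1.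
- have E : c = a by apply: (only_neighbour ntz).
  subst c; have [E|E] : d = a \/ d = b by apply: nbr; rewrite symR.
    by subst; clash.
  subst d; case: free.
  apply: (@X2_copy_avoids_closed _ [:: z; y; a; b; x] [:: b; a; y; x]) => //.
  + exact: union_sym.
  + by move=> k; rewrite !inE => /or4P[] ->; rewrite ?orbT.
  by apply: star; saturate_sym; split=> //; split; distinct.
Qed.
End NewPair.

Section NewTriangle.
Variables R B : rel nat.
Hypothesis col : colouring R B.

Let symR := red_sym col.
Let symB := blue_sym col.
Let irrR := red_irr col.
Let irrB := blue_irr col.
Let RB := red_blue col.

(** The K4 that threatens at x provides a triangle through y that avoids the two
    red neighbours of z, and z with these neighbours completes X2. *)
Lemma star_triangle x y z : B z x -> B z y -> x <> y -> ~ R x y ->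
  two_neighbours R z ->
  ~ common_neighbour R x z -> star_threat (union R B) R x y -> False.
Proof.
move=> zx zy xy nR [p [q [pq [zp zq]]]] ncom [r [s [rs xr xs noX2]]].
have rp : r <> p by move=> E; subst; apply: ncom; exists p; rewrite !(symR p).
have rq : r <> q by move=> E; subst; apply: ncom; exists q; rewrite !(symR q).
by case: noX2; find_copy [:: x; r; y; z; p; q].
Qed.

(** Within the five vertices, the two red neighbours of x can only be the inner
    vertices p and q of the red path, and q is adjacent to y. *)
Lemma square_triangle x y z : B z x -> B z y -> x <> y -> ~ R x y ->
  two_neighbours R x ->
  ~ common_neighbour R x y -> square_threat (union R B) R x y -> False.
Proof.
move=> zx zy xy nR [a [b [ab [xa xb]]]] ncom [p [q [s [xp pq qy cl]]]].
have inK t : union R B x t -> t \in [:: x; y; p; q; s].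
  by apply: cl; rewrite inE eqxx.
have zs : z = s.
  have : z \in [:: x; y; p; q; s] by apply: inK; rewrite /union symB zx orbT.
  by saturate_sym; rewrite !inE; do 4 (case/orP; first by move/eqP=> E; subst; clash); move/eqP.
subst s.
have nbr t : R x t -> t = p \/ t = q.
  move=> xt; have : t \in [:: x; y; p; q; z] by apply: inK; rewrite /union xt.
  saturate_sym; rewrite !inE; do 2 (case/orP; first by move/eqP=> E; subst; clash).
  by case/or3P=> /eqP E; auto; subst; clash.
have xq : R x q.
  have [E|E] := nbr _ xa; last by subst.
  by have [E'|E'] := nbr _ xb; subst.
by apply: ncom; exists q; rewrite symR.
Qed.

End NewTriangle.

Lemma painter_wins_X2 : painter_wins C3 (free_class X2).
Proof.
apply: (painter_wins_triangle (I := X2_invariant)) =>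
  [|R B []|R B u v col good uv nR nB free] //.
  by split=> //; split=> // w x y z [].
have [tR tB rea adj [star square]] := good.
have [re|nre] := classic (X2_blue_move R B u v); [right|left].
- have col' : colouring R (add_edge (u, v) B).
    by apply/colouring_swap/colouring_red => //; apply: colouring_swap.
  have sub x y : B x y -> add_edge (u, v) B x y := @add_edge_sub (u, v) B x y.
  have free' : ~ contains_copy (union R (add_edge (u, v) B)) X2.
    move=> cF; apply: free; apply: contains_copy_mono cF => x y.
    by rewrite /union /add_edge orbCA.
  have subU x y : union R B x y -> union R (add_edge (u, v) B) x y.
    by rewrite /union => /orP[->|/sub ->]; rewrite ?orbT.
  have free0 : ~ contains_copy (union R B) X2.
    by move=> cF; apply: free'; apply: contains_copy_mono cF.
  have [symR symB irrR irrB RB] := col.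
  have nRvu : ~ R v u by rewrite symR.
  have nBvu : ~ B v u by rewrite symB.
  have star' w x y z : red_star R w x y z ->
      contains_copy (union (union R (add_edge (u, v) B)) (clique [:: w; x; y; z])) X2.
    move/star; apply: contains_copy_mono => a b /orP[/subU|] ab;
      apply/orP; by [left|right].
  have rea' x y : add_edge (u, v) B x y -> blocked R x y.
    case/add_edgeP => [[-> ->]|[-> ->]|/rea] //.
      case: re => [?|[p [q [? ? ? _]]]|[p [q [? ? ? _]]]|[p [q [s [? ? ? _]]]]].
      - by constructor 3.
      - by constructor 1; exists p, q.
      - by constructor 2; exists p, q.
      - by constructor 4; exists p, q.
    case: re => [/common_neighbour_sym ?|[p [q [? ? ? _]]]|[p [q [? ? ? _]]]|[p [q [s [? ? ? _]]]]].
    - by constructor 3.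
    - by constructor 2; exists p, q.
    - by constructor 1; exists p, q.
    - by constructor 4; apply: path3_sym => //; exists p, q.
  have newu x : B u x -> x <> v -> ~ R x v ->
      [\/ common_neighbour R u x, common_neighbour R u v | two_neighbours R u].
    move=> ux xv nRxv; case: re => [?|[p [q [? ? ? _]]]|st|sq].
    - by constructor 2.
    - by constructor 3; exists p, q.
    - exact: (star_pair col good ux xv uv nRxv nR nB st).
    - exact: (square_pair col good free0 ux xv uv nRxv nR nB sq).
  have newv x : B v x -> x <> u -> ~ R x u ->
      [\/ common_neighbour R v x, common_neighbour R v u | two_neighbours R v].
    move=> vx xu nRxu; have vu : v <> u by move=> E; apply: uv.
    case: re => [?|st|[p [q [? ? ? _]]]|sq].
    - by constructor 2; apply: common_neighbour_sym.
    - exact: (star_pair col good vx xu vu nRxu nRvu nBvu st).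
    - by constructor 3; exists p, q.
    - apply: (square_pair col good free0 vx xu vu nRxu nRvu nBvu).
      exact: square_threat_sym.
  have adj' z x y : add_edge (u, v) B z x -> add_edge (u, v) B z y -> x <> y ->
      ~ R x y -> [\/ common_neighbour R z x, common_neighbour R z y | two_neighbours R z].
    move=> /add_edgeP[[? ?]|[? ?]|zx] /add_edgeP[[? ?]|[? ?]|zy] xny nRxy; subst; try clash.
    * have [] := newu _ zy _ _; rewrite 1?symR; auto; by [constructor 2|constructor 1|constructor 3].
    * have [] := newv _ zy _ _; rewrite 1?symR; auto; by [constructor 2|constructor 1|constructor 3].
    * exact: newu.
    * exact: newv.
    * exact: adj.
  have tri := X2_blue_triangle col' tR rea' adj' star' free'.
  have nbr z : B z u -> B z v -> False.
    move=> zu zv.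
    have uv' : add_edge (u, v) B u v by apply: add_edge_new.
    have vz' : add_edge (u, v) B v z by apply: sub; rewrite symB.
    have zu' : add_edge (u, v) B z u by apply: sub.
    have [tu tv tz ncuv] := tri _ _ _ uv' vz' zu'.
    have [_ _ _ ncvz] := tri _ _ _ vz' zu' uv'.
    have [_ _ _ nczu] := tri _ _ _ zu' uv' vz'.
    have vu : v <> u by move=> E; apply: uv.
    case: re => [//|st|st|sq].
    - by apply: (star_triangle col zu zv uv nR tz _ st) => /common_neighbour_sym.
    - exact: (star_triangle col zv zu vu nRvu tz _ st).
    - exact: (square_triangle col zu zv uv nR tu ncuv sq).
  split=> //.
  + move=> x y z /add_edgeP[[? ?]|[? ?]|xy] /add_edgeP[[? ?]|[? ?]|yz]
      /add_edgeP[[? ?]|[? ?]|zx]; subst; try clash; saturate_sym;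
      try exact: tB xy yz zx; eapply nbr; eassumption.
  + split=> // x p y q s xy pq xp py yq qx cl.
    apply: (square x p y q s) => // k t kK kt; apply: cl kK _; exact: subU.
- have col' := colouring_red col uv nR nB.
  have sub x y : R x y -> add_edge (u, v) R x y := @add_edge_sub (u, v) R x y.
  have subU x y : union R B x y -> union (add_edge (u, v) R) B x y.
    by rewrite /union => /orP[/sub|] ->; rewrite ?orbT.
  have [symR symB irrR irrB RB] := col.
  have ncom : ~ common_neighbour R u v by move=> ?; apply: nre; constructor 1.
  split=> //.
  + move=> x y z /add_edgeP[[? ?]|[? ?]|xy] /add_edgeP[[? ?]|[? ?]|yz]
      /add_edgeP[[? ?]|[? ?]|zx]; subst; try clash; saturate_sym; apply: ncom;
      find_common_neighbour.
  + move=> x y /rea[] re; [constructor 1|constructor 2|constructor 3|constructor 4].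
    * exact: two_neighbours_mono re.
    * exact: two_neighbours_mono re.
    * exact: common_neighbour_mono re.
    * exact: path3_mono re.
  + move=> z x y zx zy xny nRxy; have [] := adj _ _ _ zx zy xny.
    * by move=> ?; apply: nRxy; apply: sub.
    * by move=> ?; constructor 1; apply: common_neighbour_mono sub _.
    * by move=> ?; constructor 2; apply: common_neighbour_mono sub _.
    * by move=> ?; constructor 3; apply: two_neighbours_mono sub _.
  + split.
    * have new w x y z : R w x -> R w y -> x <> y -> w = u /\ z = v \/ w = v /\ z = u ->
          contains_copy (union (union R B) (clique [:: w; x; y; z])) X2.
        move=> wx wy xny E; apply: NNPP => noX2; apply: nre.
        by case: E => -[<- <-]; [constructor 2|constructor 3]; exists x, y.
      have mono K : contains_copy (union (union R B) (clique K)) X2 ->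
          contains_copy (union (union (add_edge (u, v) R) B) (clique K)) X2.
        apply: contains_copy_mono => a b /orP[/subU|] ab;
        apply/orP; by [left|right].
      have perm K K' : K =i K' -> contains_copy (union (union R B) (clique K)) X2 ->
          contains_copy (union (union R B) (clique K')) X2.
        by move=> eqK; apply: contains_copy_mono => a b; rewrite /union /clique !eqK.
      move=> w x y z [/add_edgeP wx /add_edgeP wy /add_edgeP wz [xny ynz xnz]].
      have permx : [:: w; y; z; x] =i [:: w; x; y; z].
        by move=> k; rewrite !inE; do ! case: eqP.
      have permy : [:: w; x; z; y] =i [:: w; x; y; z].
        by move=> k; rewrite !inE; do ! case: eqP.
      apply: mono.
      case: wx wy wz => [[? ?]|[? ?]|wx] [[? ?]|[? ?]|wy] [[? ?]|[? ?]|wz]; subst; try clash.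
      all: try (by apply: new; auto).
      all: try (by apply: (perm _ _ permx); apply: new; auto).
      all: try (by apply: (perm _ _ permy); apply: new; auto).
      by apply/star.
    * move=> x p y q s xny pnq /add_edgeP[[? ?]|[? ?]|xp] /add_edgeP[[? ?]|[? ?]|py]
        /add_edgeP[[? ?]|[? ?]|yq] /add_edgeP[[? ?]|[? ?]|qx] cl; subst; try clash.
      all: have {}cl : closed_under (union R B) [:: _; _; _; _; _] :=
        fun k t kK kt => cl k t kK (subU _ _ kt).
      all: try exact: square xny pnq xp py yq qx cl.
      all: saturate_sym; match goal with
        N : ~ X2_blue_move ?S _ ?a ?d, H1 : is_true (?S ?a ?b),
        H2 : is_true (?S ?b ?c), H3 : is_true (?S ?c ?d) |- _ =>
          apply: N; constructor 4; exists b, c, s; split=> //;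
          apply: closed_eq cl => i; rewrite !inE; do ! case: eqP => // end.
Qed.

(** * Finite plans for Builder *)

(** [Ask u v r b] draws the edge uv and goes on with [r] or [b] after the answer
    red ([true]) or blue ([false]). *)
Inductive plan := Done | Ask of nat & nat & plan & plan.

(** For vertices with both a red and a blue common neighbour. *)
Definition win u v := Ask u v Done Done.

Fixpoint swap t :=
  if t is Ask u v r b then Ask u v (swap b) (swap r) else Done.

Fixpoint follow t (cs : seq bool) {struct cs} :=
  match cs, t with
  | c :: cs', Ask _ _ r b => follow (if c then r else b) cs'
  | _, _ => t
  end.

Definition strategy t : builder_strategy := fun p =>
  if follow t (rev [seq m.2 | m <- p]) is Ask u v _ _ then (u, v) else (0, 0).

(** All plans play on the vertices below 8. *)
Definition ends_in_triangle (p : position) :=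
  if p is (u, v, c) :: _ then
    has (fun w => colour_adj p c u w && colour_adj p c v w) (iota 0 8)
  else false.

Fixpoint succeeds (safe : pred position) t (p : position) :=
  if t is Ask u v r b then
    [&& u != v, ~~ position_adj p u v, safe ((u, v, true) :: p),
        succeeds safe r ((u, v, true) :: p) & succeeds safe b ((u, v, false) :: p)]
  else ends_in_triangle p.

Lemma ends_in_triangleP p :
  (forall m, m \in p -> m.1.1 != m.1.2) -> ends_in_triangle p -> mono_copy C3 p.
Proof.
case: p => // -[[u v] c] p loopless /hasP[w _ /andP[uw vw]].
exists c; apply: (@contains_copy_seq _ _ _ [:: u; v; w]) => //.
- exact: position_adj_sym.
- have irr x : ~~ colour_adj ((u, v, c) :: p) c x x.
    apply/hasPn => m; rewrite mem_filter => /andP[_ /loopless].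
    by case: m => -[a b] d /=; apply: contra => /orP[] /eqP[-> ->].
  have uv : u != v := loopless (u, v, c) (mem_head _ _).
  rewrite /= !inE negb_or uv !andbT.
  by apply/andP; split; apply/eqP => E; subst; move: uw vw; rewrite ?(negPf (irr _)).
- have uv' : colour_adj ((u, v, c) :: p) c u v.
    by rewrite /colour_adj /= eqxx /position_adj /= eqxx.
  by apply/and4P; split=> //=; rewrite /colour_adj position_adj_sym.
Qed.

(** The run against any colour sequence follows one branch of the plan, because
    the strategy recovers the current subplan from the colours of the
    position. *)
Lemma plan_wins (C : graph_class) (safe : pred position) t :
    (forall p m, safe ((m, true) :: p) -> C (position_adj ((m, true) :: p))) ->
  succeeds safe t [::] -> builder_wins C3 C.
Proof.
move=> safeC ok; exists (strategy t) => col.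
set pos := play (strategy t) col.
have colours k : rev [seq m.2 | m <- pos k] = mkseq col k.
  by elim: k => //= k IHk; rewrite rev_cons IHk /mkseq -addn1 iotaD map_cat cats1.
have follow_rcons s cs c :
    follow s (rcons cs c) = if follow s cs is Ask _ _ r b
                            then if c then r else b else Done.
  by elim: cs s => [|c' cs IHcs] [|u v r b] //=; case: cs {IHcs}.
have reach k s : follow t (mkseq col k) = s -> succeeds safe s (pos k) ->
    (forall j, j < k -> legal_move C (pos j) (strategy t (pos j))) ->
    exists n, (forall j, j < n -> legal_move C (pos j) (strategy t (pos j)))
      /\ mono_copy C3 (pos n).
  elim: s k => [|u v r IHr b IHb] k.
    move=> _ tri legal; exists k; split=> //; apply: ends_in_triangleP tri.
    elim: k legal => //= k IHk legal m; rewrite inE => /predU1P[->|].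
      by have [] := legal k (ltnSn k).
    by apply: IHk => j /ltnW; apply: legal.
  move=> tk /and5P[uv new safek okr okb] legal.
  have move_k : strategy t (pos k) = (u, v) by rewrite /strategy colours tk.
  have legalS j : j < k.+1 -> legal_move C (pos j) (strategy t (pos j)).
    rewrite ltnS leq_eqVlt => /predU1P[->|]; last exact: legal.
    by rewrite move_k; split=> //; apply: safeC.
  have posS : pos k.+1 = (u, v, col k) :: pos k by rewrite -move_k.
  have tS : follow t (mkseq col k.+1) = if col k then r else b.
    by rewrite -colours /= rev_cons colours follow_rcons tk.
  case: (col k) posS tS => posS tS.
    by apply: (IHr k.+1) => //; rewrite posS.
  by apply: (IHb k.+1) => //; rewrite posS.
exact: (reach 0 t).
Qed.

(** Five edges at the vertex 0, of which [rs] and [bs] list the red and the blue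
    ends so far.  The triangle on three ends of the same colour cannot use that
    colour. *)
Fixpoint star_plan k (rs bs : seq nat) :=
  if k is k'.+1 then
    let x := size rs + size bs in
    match rs, bs with
    | [:: a; b; c], _ => Ask a b Done (Ask b c Done (win a c))
    | _, [:: a; b; c] => swap (Ask a b Done (Ask b c Done (win a c)))
    | _, _ => Ask 0 x.+1 (star_plan k' (x.+1 :: rs) bs) (star_plan k' rs (x.+1 :: bs))
    end
  else Done.

(** The answers to a first red edge.  A branch stops when Painter closes a
    triangle, at the latest with an edge whose ends have both a red and a blue
    common neighbour.  No vertex gets more than four edges. *)
Definition plan_degree4_red :=
  (Ask 2 3
   (Ask 0 4
    (Ask 1 5
     (Ask 4 6
      (Ask 1 7
       (Ask 5 7 Done (Ask 0 5 Done (win 0 7)))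
       (Ask 4 7 (Ask 6 7 Done (Ask 0 6 Done (win 0 7))) (win 1 4)))
      (Ask 1 6 (Ask 5 6 Done (Ask 0 6 Done (win 0 5))) (win 1 4)))
     (Ask 1 2
      (Ask 0 5
       (Ask 4 5 Done (win 1 4))
       (Ask 2 5 (Ask 3 5 Done (win 1 3)) (win 0 2)))
      (Ask 4 5 (Ask 2 4 (win 2 5) (win 1 4)) (win 1 4))))
    (Ask 5 6
     (Ask 1 7
      (Ask 0 2
       (Ask 1 4
        (Ask 4 7 Done (win 0 7))
        (Ask 2 4 (Ask 0 3 Done (win 3 4)) (win 1 2)))
       (Ask 4 7 (Ask 2 7 (win 2 4) (win 0 7)) (win 0 7)))
      (Ask 2 4
       (Ask 2 7
        (Ask 3 4 Done (Ask 3 7 Done (win 4 7)))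
        (Ask 4 5
         (Ask 1 3
          (win 1 2)
          (Ask 3 6
           (Ask 6 7 (win 3 7) (win 2 6))
           (Ask 5 7 (Ask 0 6 (win 1 6) (win 4 6)) (win 2 5))))
         (Ask 3 5 (Ask 0 3 (win 0 5) (win 3 4)) (win 3 4))))
       (Ask 4 5
        (Ask 2 6 (Ask 0 6 (win 0 2) (win 4 6)) (win 4 6))
        (Ask 2 5 (Ask 0 2 (win 0 5) Done) Done))))
     (Ask 1 4
      (Ask 1 5
       (Ask 0 5 Done (win 4 5))
       (Ask 1 6 (Ask 0 6 Done (win 4 6)) Done))
      (Ask 2 4
       (Ask 3 4 Done (Ask 0 3 (win 1 3) Done))
       (Ask 0 2 (win 1 2) Done)))))
   (Ask 4 5
    (Ask 0 6
     (Ask 1 6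
      Done
      (Ask 0 2
       (Ask 1 2 Done (win 2 6))
       (Ask 0 3 (Ask 1 3 Done (win 3 6)) Done)))
     (Ask 1 6
      (Ask 1 2
       (Ask 0 2 Done (win 2 6))
       (Ask 1 3 (Ask 0 3 Done (win 3 6)) Done))
      (Ask 4 6
       (Ask 5 6 Done (Ask 0 5 (win 1 5) Done))
       (Ask 0 4 (win 1 4) Done))))
    (Ask 2 6
     (Ask 3 6
      (Ask 4 6
       (Ask 2 4 Done (win 3 4))
       (Ask 5 6 (Ask 2 5 Done (win 3 5)) Done))
      (Ask 0 3
       (Ask 1 3 Done (Ask 1 2 (win 1 6) Done))
       (Ask 0 2 (win 0 6) Done)))
     (Ask 3 6
      (Ask 0 2
       (Ask 1 2 Done (Ask 1 3 (win 1 6) Done))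
       (Ask 0 3 (win 0 6) Done))
      Done)))).

Definition plan_degree4 := Ask 0 1 plan_degree4_red (swap plan_degree4_red).

(** As above, but now the red and the blue common neighbour of the ends of the
    last edge are not adjacent, for these four vertices would form a K4. *)
Definition plan_K4_free_red :=
  (Ask 2 3
   (Ask 0 2
    (Ask 0 3
     Done
     (Ask 1 4
      (Ask 3 4
       (Ask 0 5
        (Ask 2 5
         Done
         (Ask 4 6
          (Ask 2 4 Done (Ask 5 6 (win 4 5) (Ask 1 6 Done (win 1 5))))
          (Ask 1 5 Done (Ask 2 6 (Ask 0 6 Done (win 0 4)) (win 2 4)))))
        (Ask 4 5 (win 3 5) (win 0 4)))
       (win 0 4))
      (Ask 2 4
       (Ask 3 4
        Done
        (Ask 1 5 (Ask 3 5 (win 1 3) (win 0 5)) (Ask 2 5 (win 4 5) (win 1 2))))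
       (win 1 2))))
    (Ask 1 4
     (Ask 3 4
      (Ask 0 4 Done (win 2 4))
      (Ask 2 5
       (Ask 4 5 (Ask 2 4 Done (win 0 4)) (win 3 5))
       (Ask 1 5 (win 0 5) (Ask 2 4 (win 1 2) (win 0 4)))))
     (Ask 0 5
      (Ask 4 5
       (Ask 3 4 (Ask 2 4 Done (win 0 4)) (Ask 0 3 (win 1 3) (win 0 4)))
       (win 1 5))
      (Ask 3 5
       (win 2 5)
       (Ask 3 4 (Ask 0 4 (win 0 3) (win 2 4)) (Ask 1 3 (win 0 3) Done))))))
   (Ask 0 2
    (Ask 3 4
     (Ask 1 4
      (Ask 1 2 Done (win 1 3))
      (Ask 3 5
       (Ask 1 5 (Ask 1 3 Done (win 1 2)) (win 4 5))
       (Ask 0 5 (win 2 5) (Ask 1 3 (win 0 3) (win 1 2)))))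
     (Ask 0 4 (win 2 4) (Ask 1 3 (win 0 3) (win 1 2))))
    (Ask 1 4
     (Ask 1 3 (win 0 3) (Ask 2 4 (win 1 2) (win 0 4)))
     (Ask 3 4
      (Ask 1 5
       (Ask 2 5 (Ask 1 3 (win 0 3) (win 1 2)) (win 0 5))
       (Ask 3 5 (win 4 5) (Ask 1 3 (win 0 3) Done)))
      (Ask 0 3 (win 1 3) Done))))).

Definition plan_K4_free := Ask 0 1 plan_K4_free_red (swap plan_K4_free_red).

(** * Searching for copies of a pattern *)

Definition joins (s : seq (nat * nat)) : rel nat :=
  fun x y => ((x, y) \in s) || ((y, x) \in s).

Lemma joins_sym s : symmetric (joins s).
Proof. by move=> x y; rewrite /joins orbC. Qed.

Lemma position_adjE p : position_adj p =2 joins [seq m.1 | m <- p].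
Proof.
move=> x y; elim: p => // m p; rewrite /position_adj /joins /= !inE => ->.
by rewrite ![_ == m.1]eq_sym -!orbA; do ! bool_congr.
Qed.

(** Backtracking search for a copy of the edge list [s] in [E]: [l] lists the
    images chosen so far, and [k] vertices remain.  The conditionals replace
    conjunctions because those would be evaluated on both sides. *)
Fixpoint extends (s : seq (nat * nat)) (E : rel nat) (vs : seq nat) k l :=
  if k is k'.+1 then
    has (fun x =>
      if x \in l then false else
      if all (fun e => if maxn e.1 e.2 == size l
                       then E (nth 0 l (minn e.1 e.2)) x else true) s
      then extends s E vs k' (rcons l x) else false) vs
  else true.

Definition graph_edges n (s : seq (nat * nat)) :=
  all (fun e => [&& e.1 != e.2, e.1 < n & e.2 < n]) s.

Lemma min_lt_max (e : nat * nat) : e.1 != e.2 -> minn e.1 e.2 < maxn e.1 e.2.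
Proof. by rewrite /minn /maxn; case: (ltngtP e.1 e.2). Qed.

Lemma min_max_sym (E : rel nat) (f : nat -> nat) e : symmetric E ->
  E (f (minn e.1 e.2)) (f (maxn e.1 e.2)) = E (f e.1) (f e.2).
Proof. by move=> symE; rewrite /minn /maxn; case: ifP => // _; rewrite symE. Qed.

Lemma extends_complete n s (E : rel nat) vs (f : nat -> nat) : symmetric E ->
    graph_edges n s -> {in gtn n &, injective f} ->
    (forall i, i < n -> f i \in vs) ->
    (forall e, e \in s -> E (f e.1) (f e.2)) ->
  extends s E vs n [::].
Proof.
move=> symE /allP gs injf fvs Ef.
suff ext k m : k + m = n -> extends s E vs k (mkseq f m) by apply: (ext n 0); rewrite addn0.
elim: k m => //= k IHk m km.
have ltmn : m < n by rewrite -km addSn ltnS leq_addl.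
apply/hasP; exists (f m); first exact: fvs.
rewrite ifF; last first.
  apply/negbTE/mapP => -[j]; rewrite mem_iota add0n => /andP[_ ltjm] fmj.
  have mj : m = j by apply: injf fmj; rewrite ?inE //; apply: ltn_trans ltmn.
  by rewrite mj ltnn in ltjm.
rewrite ifT.
  by rewrite -mkseqS; apply: IHk; rewrite addnS.
apply/allP => e es; case: ifP => //; rewrite size_mkseq => /eqP max_e.
have /and3P[/min_lt_max lt _ _] := gs e es.
by rewrite nth_mkseq -max_e // min_max_sym //; apply: Ef.
Qed.

Lemma extends_sound n s (E : rel nat) vs : symmetric E ->
    graph_edges n s -> extends s E vs n [::] ->
  exists l, [/\ size l = n, uniq l, {subset l <= vs} &
    forall e, e \in s -> E (nth 0 l e.1) (nth 0 l e.2)].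
Proof.
move=> symE /allP gs.
pose partial l := [/\ uniq l, {subset l <= vs} &
  forall e, e \in s -> maxn e.1 e.2 < size l -> E (nth 0 l e.1) (nth 0 l e.2)].
suff ext k l : k + size l = n -> partial l -> extends s E vs k l ->
    exists2 l', size l' = n & partial l'.
  case/(ext n [::]) => [||l sl [ul lvs El]]; first by rewrite addn0.
    by split.
  exists l; split=> // e es; apply: El => //.
  by have /and3P[_ lt1 lt2] := gs e es; rewrite sl gtn_max lt1.
elim: k l => [|k IHk] l; first by move=> sl pl _; exists l.
move=> kl [ul lvs El] /hasP[x xvs]; case: ifP => // /negbT xl; case: ifP => // /allP new.
apply: IHk; first by rewrite size_rcons addnS.
split; first by rewrite rcons_uniq xl.
  by move=> y; rewrite mem_rcons inE => /predU1P[->|/lvs].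
move=> e es; rewrite size_rcons ltnS leq_eqVlt => /orP[max_e|max_e]; last first.
  have := El e es max_e; rewrite gtn_max in max_e; case/andP: max_e => lt1 lt2.
  by rewrite !nth_rcons lt1 lt2.
have /and3P[/min_lt_max lt _ _] := gs e es.
have := new e es; rewrite max_e => Enew.
rewrite -(min_max_sym (nth 0 (rcons l x)) e symE) !nth_rcons (eqP max_e) ltnn eqxx.
by rewrite -{1}(eqP max_e) lt.
Qed.

(** * The graphs against which Builder wins *)

Definition K4 := [:: (0, 1); (0, 2); (1, 2); (0, 3); (1, 3); (2, 3)].
Definition star5 := [:: (0, 1); (0, 2); (0, 3); (0, 4); (0, 5)].
Definition forked_diamond :=
  [:: (0, 1); (0, 2); (1, 2); (1, 3); (2, 3); (0, 4); (0, 5)].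
Definition K4_two_leaves :=
  [:: (0, 1); (0, 2); (0, 3); (0, 4); (0, 5); (1, 2); (1, 3); (2, 3)].

Definition covers n (s : seq (nat * nat)) :=
  all (fun i => has (fun e => (e.1 == i) || (e.2 == i)) s) (iota 0 n).

(** Duplicates would multiply the cost of the search. *)
Definition vertices (p : position) :=
  undup (flatten [seq [:: m.1.1; m.1.2] | m <- p]).

Definition avoids n s (p : position) :=
  ~~ extends s (position_adj p) (vertices p) n [::].

Lemma coversP n s i : covers n s -> i < n -> exists j, joins s i j.
Proof.
move=> /allP cov ltin; have /hasP[e es] : has (fun e => (e.1 == i) || (e.2 == i)) s.
  by apply: cov; rewrite mem_iota.
by case/orP => /eqP <-; [exists e.2|exists e.1]; rewrite /joins -surjective_pairing es ?orbT.
Qed.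

Lemma joins_bound n s i j : graph_edges n s -> joins s i j -> i < n.
Proof. by move=> /allP gs /orP[] /gs /and3P[]. Qed.

Lemma avoids_free n s p : 0 < n -> graph_edges n s -> covers n s ->
  avoids n s p -> ~ contains_copy (position_adj p) (graph_of_edges n s).
Proof.
case: n => // n _ gs cov /negP noext [f [injf Ef]]; apply: noext.
have Es i j : joins s i j -> position_adj p (f (inord i)) (f (inord j)).
  move=> sij; apply: Ef; rewrite /edge /= /edges_rel /=.
  have ltj : j < n.+1 by apply: (joins_bound gs); rewrite joins_sym; exact: sij.
  have lti := joins_bound gs sij.
  rewrite -val_eqE /= !inordK // [_ || _]sij andbT.
  by case/orP: sij => /(allP gs) /and3P[] //=; rewrite eq_sym.
apply: (@extends_complete _ _ _ _ (fun i => f (inord i))) => //.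
- exact: position_adj_sym.
- move=> i j lti ltj /injf/(congr1 val); rewrite /= !inordK //.
- move=> i lti; have [j /Es] := coversP cov lti.
  rewrite /vertices mem_undup => /hasP[m mp] /orP[] /eqP me; apply/flattenP;
    exists [:: m.1.1; m.1.2]; rewrite ?me ?inE ?eqxx ?orbT //;
    by apply/mapP; exists m; rewrite ?me.
- by move=> e es; apply: Es; rewrite /joins -surjective_pairing es.
Qed.

Section Pattern.
Variable F : sgraph.
Hypothesis hF : no_isolated_vertices F.

Lemma copy_bound n s (h : F -> nat) : graph_edges n s ->
  (forall x y, edge x y -> joins s (h x) (h y)) -> forall x, h x < n.
Proof. by move=> gs hE x; have [y /hE/(joins_bound gs)] := hF x. Qed.

Lemma joins_iso n s : graph_edges n s -> contains_copy (joins s) F ->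
  iso_to_subgraph F (graph_of_edges n s).
Proof.
move=> gs [h [injh hE]]; have lth := copy_bound gs hE.
exists (fun x => Ordinal (lth x) : graph_of_edges n s); split.
  by move=> x y /(congr1 val)/injh.
move=> x y xy; apply/andP; split; last exact: hE.
by rewrite -val_eqE /=; apply/eqP => /injh E; rewrite E edge_irrefl in xy.
Qed.

Definition embeds s t := graph_edges 6 s && extends s (joins t) (iota 0 6) 6 [::].

Lemma embeds_copy s t : embeds s t ->
  contains_copy (joins s) F -> contains_copy (joins t) F.
Proof.
move=> /andP[gs /(extends_sound (joins_sym t) gs)[l [sl ul _ El]]] [h [injh hE]].
have lth := copy_bound gs hE.
exists (fun x => nth 0 l (h x)); split.
  by move=> x y /eqP; rewrite nth_uniq ?sl // => /eqP/injh.
by move=> x y /hE/orP[] /El //=; rewrite joins_sym.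
Qed.

Definition onto (h : F -> nat) (s : seq (nat * nat)) :=
  forall e, e \in s -> exists x y, [/\ edge x y, h x = e.1 & h y = e.2].

Lemma onto_joins h s i j : onto h s -> joins s i j ->
  exists x y, [/\ edge x y, h x = i & h y = j].
Proof.
move=> on /orP[] /on [x [y [xy hx hy]]]; first by exists x, y.
by exists y, x; rewrite edge_sym.
Qed.

Lemma onto_contains h n s t : injective h -> onto h s ->
    graph_edges n t -> covers n t -> extends t (joins s) (iota 0 6) n [::] ->
  iso_to_subgraph (graph_of_edges n t) F.
Proof.
move=> injh on gt cov /(extends_sound (joins_sym s) gt)[l [sl ul _ El]].
have Et i j : joins t i j -> joins s (nth 0 l i) (nth 0 l j).
  by case/orP=> /El //=; rewrite joins_sym.
have ex (i : 'I_n) : exists x, h x == nth 0 l i.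
  have [j /Et/(onto_joins on)[x [y [_ hx _]]]] := coversP cov (ltn_ord i).
  by exists x; apply/eqP.
pose g i := xchoose (ex i); have gE i : h (g i) = nth 0 l i := eqP (xchooseP (ex i)).
exists g; split.
  move=> i j /(congr1 h); rewrite !gE => /eqP; rewrite nth_uniq ?sl ?ltn_ord //.
  by move=> /eqP; exact: val_inj.
move=> i j /andP[_ /Et/(onto_joins on)[x [y [xy]]]].
by rewrite -!gE => /injh <- /injh <-.
Qed.

(** A copy of F in [s] either uses all edges of [s], or it is a copy in a smaller
    edge list. *)
Lemma onto_or_missing h s : (forall x y, edge x y -> joins s (h x) (h y)) ->
  onto h s \/ exists2 e, e \in s &
    forall x y, edge x y -> joins [seq e' <- s | e' != e] (h x) (h y).
Proof.
move=> hE; have [on|] := classic (onto h s); [by left | move=> non; right].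
apply: NNPP => nomiss; apply: non => e es; apply: NNPP => miss; apply: nomiss.
exists e => // x y xy; have := hE x y xy; rewrite /joins !mem_filter.
have ne1 : (h x, h y) != e.
  by apply/eqP => E; apply: miss; exists x, y; rewrite -E.
have ne2 : (h y, h x) != e.
  by apply/eqP => E; apply: miss; exists y, x; rewrite -E edge_sym.
by rewrite ne1 ne2.
Qed.

End Pattern.

Definition X1_edges := [:: (0, 1); (1, 2); (2, 0); (0, 3); (0, 4); (1, 5)].
Definition X2_edges := [:: (0, 1); (1, 2); (2, 0); (2, 3); (3, 4); (3, 5)].
Definition X3_edges := [:: (0, 1); (0, 2); (0, 3); (1, 2); (1, 3); (0, 4)].
Definition X4_edges := [:: (0, 1); (0, 2); (0, 3); (1, 2); (1, 3); (2, 4)].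
Definition X5_edges := [:: (0, 1); (1, 2); (2, 3); (3, 0); (0, 4); (0, 5)].

Definition painter_graphs := [:: X1_edges; X2_edges; X3_edges; X4_edges].

Definition contains S nt := extends nt.2 (joins S) (iota 0 6) nt.1 [::].
Definition builder_graphs := [:: (4, K4); (6, star5); (6, forked_diamond)].

(** Deleting edges from [S] in any order leads to a subgraph of some X_i or of
    X5, and every edge list passed on the way contains a graph against which
    Builder wins.  At most [k] edges are deleted. *)
Fixpoint reducible k S :=
  if has (embeds S) painter_graphs then true else
  if embeds S X5_edges then true else
  if has (contains S) builder_graphs then
    if k is k'.+1 then all (fun e => reducible k' [seq e' <- S | e' != e]) S
    else false
  else false.

Lemma builder_graphs_wf :
  all (fun nt => [&& 0 < nt.1, graph_edges nt.1 nt.2 & covers nt.1 nt.2])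
    builder_graphs.
Proof. by []. Qed.

Lemma K4_two_leaves_reducible : reducible 8 K4_two_leaves. Proof. by vm_compute. Qed.

Lemma X5_reducible :
  all (fun e => has (embeds [seq e' <- X5_edges | e' != e]) painter_graphs) X5_edges.
Proof. by vm_compute. Qed.

Section Classify.
Variable F : sgraph.
Hypothesis hF : no_isolated_vertices F.

(** Follow the deletions as long as the copy of F misses an edge.  When it misses
    none, F contains whatever the current edge list contains. *)
Lemma reducible_sound k S (h : F -> nat) : injective h ->
    (forall x y, edge x y -> joins S (h x) (h y)) -> reducible k S ->
  [\/ exists2 s, s \in painter_graphs & contains_copy (joins s) F,
      contains_copy (joins X5_edges) F
    | exists2 nt, nt \in builder_graphs & iso_to_subgraph (graph_of_edges nt.1 nt.2) F].
Proof.
move=> injh; elim: k S => [|k IHk] S hE; rewrite /reducible -/reducible.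
all: case: ifP => [/hasP[s sm emb] _|_].
1,3: by constructor 1; exists s => //; apply: embeds_copy emb _ => //; exists h.
all: case: ifP => [emb _|_].
1,3: by constructor 2; apply: embeds_copy emb _ => //; exists h.
all: case: ifP => //.
move=> /hasP[nt tnt cont] /allP red.
have [on|[e eS miss]] := onto_or_missing hE.
  constructor 3; exists nt => //; have /and3P[_ gs cov] := allP builder_graphs_wf _ tnt.
  exact: (onto_contains injh on gs cov cont).
by apply: (IHk _ miss); apply: red.
Qed.

Lemma X5_or_smaller : contains_copy (joins X5_edges) F ->
  isomorphic F X5 \/ exists2 s, s \in painter_graphs & contains_copy (joins s) F.
Proof.
move=> [h [injh hE]]; have [on|[e eX miss]] := onto_or_missing hE; last first.
  right; have /hasP[s sm emb] := allP X5_reducible e eX.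
  by exists s => //; apply: embeds_copy emb _ => //; exists h.
left; have lth : forall x, h x < 6 := copy_bound hF (isT : graph_edges 6 X5_edges) hE.
have cov : covers 6 X5_edges by [].
have ex (i : X5) : exists x, h x == i.
  have [j /(onto_joins on)[x [y [_ hx _]]]] := coversP cov (ltn_ord i).
  by exists x; apply/eqP.
exists (fun x => Ordinal (lth x) : X5); split.
  exists (fun i => xchoose (ex i)) => [x|i].
    by apply: injh; apply/eqP; apply: (xchooseP (ex (Ordinal (lth x)))).
  by apply: val_inj; apply/eqP; apply: (xchooseP (ex i)).
move=> x y; apply/idP/idP => [/andP[_ /(onto_joins on)[x' [y' [xy]]]]|xy].
  by move=> /injh <- /injh <-.
apply/andP; split; last exact: hE.
by rewrite -val_eqE /=; apply/eqP => /injh E; rewrite E edge_irrefl in xy.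
Qed.

Lemma builder_wins_avoiding n s t : 0 < n -> graph_edges n s -> covers n s ->
    succeeds (avoids n s) t [::] -> iso_to_subgraph (graph_of_edges n s) F ->
  builder_wins C3 (free_class F).
Proof.
move=> n0 gs cov ok sub; apply: plan_wins ok => p m av cF.
by apply: (avoids_free n0 gs cov av); apply: contains_copy_trans cF.
Qed.

Definition within_K4_two_leaves (p : position) :=
  embeds [seq m.1 | m <- p] K4_two_leaves.

(** Every board that the star plan produces embeds into K4 with two leaves at one
    vertex. *)
Lemma builder_wins_star : ~ contains_copy (joins K4_two_leaves) F ->
  builder_wins C3 (free_class F).
Proof.
move=> nF; apply: (@plan_wins _ within_K4_two_leaves (star_plan 6 [::] [::]));
  last by vm_compute.
move=> p m emb cF; apply: nF; apply: (embeds_copy hF emb).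
by apply: contains_copy_mono cF => x y; rewrite position_adjE.
Qed.

Lemma plan_K4_free_ok : succeeds (avoids 4 K4) plan_K4_free [::].
Proof. by vm_compute. Qed.

Lemma plan_degree4_star5 : succeeds (avoids 6 star5) plan_degree4 [::].
Proof. by vm_compute. Qed.

Lemma plan_degree4_forked : succeeds (avoids 6 forked_diamond) plan_degree4 [::].
Proof. by vm_compute. Qed.

Lemma builder_wins_on nt : nt \in builder_graphs ->
  iso_to_subgraph (graph_of_edges nt.1 nt.2) F -> builder_wins C3 (free_class F).
Proof.
rewrite !inE => /or3P[] /eqP-> sub.
- exact (builder_wins_avoiding (n := 4) (s := K4) isT isT isT plan_K4_free_ok sub).
- exact (builder_wins_avoiding (n := 6) (s := star5) isT isT isT plan_degree4_star5 sub).
- exact (builder_wins_avoiding (n := 6) (s := forked_diamond) isT isT isT plan_degree4_forked sub).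
Qed.

Lemma painter_wins_mono G : iso_to_subgraph F G ->
  painter_wins C3 (free_class G) -> painter_wins C3 (free_class F).
Proof.
move=> sub pG [sigma win]; apply: pG; exists sigma => col.
have [n [legal mono]] := win col; exists n; split=> // k /legal[ne new free].
by split=> // cG; apply: free; apply: contains_copy_trans sub cG.
Qed.

End Classify.

Theorem theorem3p1 (F : sgraph)
    (hF : no_isolated_vertices F) (hX5 : ~ isomorphic F X5) :
  painter_wins C3 (free_class F) <->
  [\/ iso_to_subgraph F X1, iso_to_subgraph F X2,
      iso_to_subgraph F X3 | iso_to_subgraph F X4].
Proof.
split=> [pw|[] sub]; last first.
- exact: painter_wins_mono sub painter_wins_X4.
- exact: painter_wins_mono sub painter_wins_X3.
- exact: painter_wins_mono sub painter_wins_X2.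
- exact: painter_wins_mono sub painter_wins_X1.
have painter_sub : (exists2 s, s \in painter_graphs & contains_copy (joins s) F) ->
    [\/ iso_to_subgraph F X1, iso_to_subgraph F X2,
        iso_to_subgraph F X3 | iso_to_subgraph F X4].
  case=> s; rewrite !inE => /or4P[] /eqP-> /(joins_iso hF) sub.
  - by constructor 1; apply: sub.
  - by constructor 2; apply: sub.
  - by constructor 3; apply: sub.
  - by constructor 4; apply: sub.
have [[h [injh hE]]|nsub] := classic (contains_copy (joins K4_two_leaves) F); last first.
  by case: pw; apply: builder_wins_star.
have [//|/(X5_or_smaller hF)[//|]//|[nt tnt sub]] :=
  reducible_sound hF injh hE K4_two_leaves_reducible; try exact: painter_sub.
by case: pw; apply: builder_wins_on tnt sub.
Qed.
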